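(* Let $n\ge2$ and let $I\subseteq\mathbb{R}$ be a non-degenerate interval. A function $M:I^n\to I$ is a generalized $n$-variable quasi-arithmetic mean (i.e., there exist continuous strictly increasing functions $f_1,\dots,f_n:I\to\mathbb{R}$ with $M=A_{f_1,\dots,f_n}$) if and only if (i) $M$ is a $CM$-function on $I^n$; (ii) $M$ is reflexive, i.e., $M(x,\dots,x)=x$ for all $x\in I$; (iii) $\Gamma(M^{\langle 0\rangle},\dots,M^{\langle n-1\rangle})$ is a $CM$-function and $M$ is generalized bisymmetric, that is, for all $x_{i,j}\in I$ ($i,j\in\{1,\dots,n\}$), $$\Gamma(M^{\langle 0\rangle},\dots,M^{\langle n-1\rangle})\big(M^{\langle 0\rangle}(x_{1,1},\dots,x_{1,n}),\dots,M^{\langle n-1\rangle}(x_{n,1},\dots,x_{n,n})\big)=\Gamma(M^{\langle 0\rangle},\dots,M^{\langle n-1\rangle})\big(M^{\langle 0\rangle}(x_{1,1},\dots,x_{n,1}),\dots,M^{\langle n-1\rangle}(x_{1,n},\dots,x_{n,n})\big).$$ (On the left-hand side the $i$th argument is $M^{\langle i-1\rangle}(x_{i,1},\dots,x_{i,n})$; on the right-hand side the $j$th argument is $M^{\langle j-1\rangle}(x_{1,j},\dots,x_{n,j})$.)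
   Context: Let $I\subseteq\mathbb{R}$ be a non-degenerate interval. Means: a function $M:I^n\to I$ is an ($n$-variable) mean if $\min(x_1,\dots,x_n)\le M(x_1,\dots,x_n)\le\max(x_1,\dots,x_n)$ for all $x_1,\dots,x_n\in I$; it is a strict mean if both inequalities are strict whenever $\min(x_1,\dots,x_n)<\max(x_1,\dots,x_n)$. $CM$-function: a function $F:I^n\to I$ that is continuous and strictly increasing in each of its variables. (A reflexive $CM$-function is a continuous strict mean, so, given (i) and (ii), the Gauss composition in (iii) is well defined.) Generalized quasi-arithmetic mean: for continuous strictly increasing $f_1,\dots,f_n:I\to\mathbb{R}$, $A_{f_1,\dots,f_n}(x_1,\dots,x_n):=(f_1+\cdots+f_n)^{-1}(f_1(x_1)+\cdots+f_n(x_n))$ for $x_1,\dots,x_n\in I$. Cyclic permutation: $\sigma:\{1,\dots,n\}\to\{1,\dots,n\}$, $\sigma(1)=n$ and $\sigma(k)=k-1$ for $k\in\{2,\dots,n\}$. For an $n$-variable mean $M:I^n\to I$ and $i\in\mathbb{Z}$, $M^{\langle i\rangle}(x_1,\dots,x_n):=M(x_{\sigma^i(1)},\dots,x_{\sigma^i(n)})$. Gauss composition: if $M_1,\dots,M_n:I^n\to I$ are continuous strict means, it is known that there is a unique continuous strict mean $K:I^n\to I$ such that the iterates $(M_1,\dots,M_n)^k$ of the map $(M_1,\dots,M_n):I^n\to I^n$ converge pointwise to $(K,\dots,K)$ as $k\to\infty$; moreover $K$ is the unique mean satisfying $K\circ(M_1,\dots,M_n)=K$. This $K$ is called the Gauss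 composition of $M_1,\dots,M_n$ and is denoted $\Gamma(M_1,\dots,M_n)$. *)

(* Defs.v *)
(* Functions on I ^ n are total functions on row vectors;
   every notion below only constrains their values on [cube I]. *)
From HB Require Import structures.
From mathcomp Require Import all_boot all_order all_algebra.
From mathcomp Require Import all_classical all_reals all_analysis.

Set Implicit Arguments.
Unset Strict Implicit.
Unset Printing Implicit Defensive.

Import Order.TTheory GRing.Theory Num.Theory.
Import numFieldNormedType.Exports.

Local Open Scope classical_set_scope.
Local Open Scope ring_scope.

Section Means.
Context {R : realType} {n : nat}.
Implicit Types (I : set R) (M K F : 'rV[R]_n -> R) (x y : 'rV[R]_n).

Definition nondegenerate_interval I : Prop :=
  is_interval I /\ exists a b, [/\ I a, I b & a < b].

Definition cube I : set 'rV[R]_n := [set x | forall i, I (x ord0 i)].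

(* The default element is the first coordinate, so that for 0 < n these are
   the true minimum and maximum of the coordinates. *)
Definition min_coord x : R :=
  \big[Num.min/head 0 [seq x ord0 i | i : 'I_n]]_(i < n) x ord0 i.

Definition max_coord x : R :=
  \big[Num.max/head 0 [seq x ord0 i | i : 'I_n]]_(i < n) x ord0 i.

Definition is_mean I M : Prop :=
  set_fun (cube I) I M /\
  forall x, cube I x -> min_coord x <= M x <= max_coord x.

Definition is_strict_mean I M : Prop :=
  is_mean I M /\
  forall x, cube I x -> min_coord x < max_coord x ->
    min_coord x < M x < max_coord x.

Definition strictly_increasing_in_each_variable I F : Prop :=
  forall (i : 'I_n) x y, cube I x -> cube I y ->
    (forall j, j != i -> x ord0 j = y ord0 j) ->
    x ord0 i < y ord0 i -> F x < F y.

Definition is_CM I F : Prop :=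
  [/\ set_fun (cube I) I F,
      {within cube I, continuous F} &
      strictly_increasing_in_each_variable I F].

Definition reflexive_mean I M : Prop := forall t, I t -> M (const_mx t) = t.

Definition gqa_mean I (f : 'I_n -> R -> R) x : R :=
  pinv I (fun t => \sum_(i < n) f i t) (\sum_(i < n) f i (x ord0 i)).

Definition is_gqa_mean I M : Prop :=
  exists f : 'I_n -> R -> R,
    [/\ forall i, {within I, continuous (f i)},
        forall i, {in I &, {homo f i : s t / s < t}} &
        {in cube I, M =1 gqa_mean I f}].

(* M^<i>; with indices counted from 0 the cyclic permutation, 0 |-> n - 1 and
   k |-> k - 1, is [ord_pred]. *)
Definition cyclic_shift M (i : nat) x : R :=
  M (\row_j x ord0 (iter i (@ord_pred n) j)).

Definition mean_map (Ms : 'I_n -> 'rV[R]_n -> R) x : 'rV[R]_n := \row_i Ms i x.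

Definition is_gauss_composition I (Ms : 'I_n -> 'rV[R]_n -> R) K : Prop :=
  [/\ is_strict_mean I K,
      {within cube I, continuous K} &
      forall x, cube I x ->
        (fun k => iter k (mean_map Ms) x) @ \oo --> (const_mx (K x) : 'rV[R]_n)].

(* Well defined on [cube I] as soon as the Ms are continuous strict means;
   values outside [cube I] are arbitrary. *)
Definition gauss_composition I (Ms : 'I_n -> 'rV[R]_n -> R) : 'rV[R]_n -> R :=
  get (is_gauss_composition I Ms).

Definition cyclic_gauss I M : 'rV[R]_n -> R :=
  gauss_composition I (fun i : 'I_n => cyclic_shift M i).

Definition generalized_bisymmetric I M : Prop :=
  forall x : 'M[R]_n, (forall i j, I (x i j)) ->
    cyclic_gauss I M (\row_i cyclic_shift M i (\row_j x i j)) =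
    cyclic_gauss I M (\row_j cyclic_shift M j (\row_i x i j)).

End Means.

(* Main.v *)
Require Import Defs.
From mathcomp Require Import all_boot all_order all_algebra.
From mathcomp Require Import all_classical all_reals all_analysis.
From mathcomp Require Import ring lra.

(** Let K be the Gauss composition of the cyclic shifts of M and index the n
    coordinates by Z/n.  A representation M = A_(f_1, ..., f_n) amounts to a
    scale for M, that is, a strictly increasing F with
    F(M(x)) = f_1(x_1) + ... + f_n(x_n): reflexivity then forces
    F = f_1 + ... + f_n.

    Necessity.  If M has a scale F, the map x |-> (M^<0>(x), ..., M^<n-1>(x))
    preserves the sum of the F(x_k), because each f_j meets each x_k once
    ([additive_cyclic]).  Hence K can only be the quasi-arithmetic mean
    generated by F, and the iterates do converge to that mean: while some
    coordinate stays above K(x) by a fixed amount, F at the largest coordinate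
    drops by a fixed amount at every step, since another coordinate lies below
    K(x) ([cyclic_map_upper]).  Bisymmetry becomes the equality of two orders of
    summation of one double sum ([gqa_bisymmetric]).

    Sufficiency.  Let Y i k be the entry that row i feeds to slot k of M.
    Bisymmetry reads K_i (M_k (Y i k)) = K_j (M_k (Y (k - j) k)), where a
    subscript names the running argument.  Fix a base point o and let Y equal o
    except in slot 0 and in one entry of slot -1.  If x + y is defined by
    K(x + y, o, ..., o) = K(x, y, o, ..., o), the result is that y may be moved
    from one argument of K to the next one:
    K(x_0 + y, x_1, x_2, ...) = K(x_0, x_1 + y, x_2, ...) ([K_exchange]).
    So + is commutative and associative and K(x) depends only on the total sum
    of its arguments.  Counting multiples of ever smaller elements, as in
    Hoelder's theorem, yields an additive g ([truncated_semigroup_scale]), and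
    reflexivity of K turns additivity into the averaging rule
    n g(K(x)) = g(x_1) + ... + g(x_n) on an interval [o, d] ([local_scale]).

    This is local because the equations that define + must be solvable.  To
    reach all of I, take e inside the interval where g is known, and let row 0
    of Y be x and all other entries be e: K(M(x), e, ..., e) is the value of K
    at the points t_j(x_j), where t_j(u) is M at u in slot j and e elsewhere
    ([kapM]).  The maps t_j and k(u) = K(u, e, ..., e) pull I strictly towards
    e, and by the averaging rule k divides g - g(e) by n.  So
    F = n^m (g o k^m - g(e)), m large, is well defined on I; and if F averages
    K at the points t_j(x_j), then F(M(x)) is the sum of the F(t_j(x_j)).  That
    is a scale for M on a larger set, where the sum-preserving map of the first
    part makes F average K again ([additive_gauss]).  Induction exhausts I
    ([shrink_cover], [additive_extension]).  Continuity of the summands costs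
    nothing: a jump of F at c would also be a jump of each of the n summands,
    but these jumps add up to the one of F ([small_increment]). *)

Set Implicit Arguments.
Unset Strict Implicit.
Unset Printing Implicit Defensive.

Import Order.TTheory GRing.Theory Num.Theory.
Import numFieldNormedType.Exports.

Local Open Scope classical_set_scope.
Local Open Scope ring_scope.

(** * Increasing functions on a set *)

Lemma increasing_le {R : realType} (D : set R) (h : R -> R) :
  (forall x y, D x -> D y -> x < y -> h x < h y) ->
  forall x y, D x -> D y -> x <= y -> h x <= h y.
Proof.
by move=> hlt x y Dx Dy; rewrite le_eqVlt => /orP[/eqP ->//|xy]; apply/ltW/hlt.
Qed.

Lemma increasing_inj {R : realType} (D : set R) (h : R -> R) :
  (forall x y, D x -> D y -> x < y -> h x < h y) ->
  forall x y, D x -> D y -> h x = h y -> x = y.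
Proof.
move=> hlt x y Dx Dy E; have [xy|yx|//] := ltgtP x y.
  by have := hlt _ _ Dx Dy xy; rewrite E ltxx.
by have := hlt _ _ Dy Dx yx; rewrite E ltxx.
Qed.

Lemma increasing_sum {R : realType} {n : nat} (D : set R)
    (f : 'I_n.+1 -> R -> R) :
  (forall i x y, D x -> D y -> x < y -> f i x < f i y) ->
  forall x y, D x -> D y -> x < y -> \sum_i f i x < \sum_i f i y.
Proof.
move=> flt x y Dx Dy xy; apply: ltr_sum => [|i _]; last exact: flt.
by apply/hasP; exists ord0 => //; rewrite mem_index_enum.
Qed.

(** * Additive scales on truncated ordered semigroups *)

(** [op] models addition cut off at [b] on [o, b]: associativity holds
    everywhere, but strict monotonicity only below the cut. *)
Section TruncatedSemigroup.
Context {R : realType} (o b : R) (op : R -> R -> R).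
Let T x := o <= x <= b.
Hypothesis ob : o < b.
Hypothesis opT : forall x y, T x -> T y -> T (op x y).
Hypothesis opC : forall x y, T x -> T y -> op x y = op y x.
Hypothesis opA : forall x y z, T x -> T y -> T z ->
  op x (op y z) = op (op x y) z.
Hypothesis op0 : forall x, T x -> op o x = x.
Hypothesis op_le : forall x y z, T x -> T y -> T z -> x <= y ->
  op x z <= op y z.
Hypothesis op_lt : forall x y z, T x -> T y -> T z -> x < y ->
  op x z < b -> op x z < op y z.
Hypothesis op_half : forall x, T x -> exists h, T h /\ op h h = x.
Hypothesis op_sub : forall x y, T x -> T y -> x <= y ->
  exists z, T z /\ op x z = y.

Let op_ler x y z : T x -> T y -> T z -> x <= y -> op z x <= op z y.
Proof. by move=> Tx Ty Tz xy; rewrite (opC Tz Tx) (opC Tz Ty) op_le. Qed.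

Definition multiple j u := iter j (op u) o.

Let To : T o. Proof. by rewrite /T lexx ltW. Qed.

Lemma multipleT j u : T u -> T (multiple j u).
Proof. by move=> Tu; elim: j => [|j IH] //=; apply: opT. Qed.

Lemma multiple1 u : T u -> multiple 1 u = u.
Proof. by move=> Tu; rewrite /multiple /= opC ?op0. Qed.

Lemma multipleD i j u : T u ->
  multiple (i + j) u = op (multiple i u) (multiple j u).
Proof.
move=> Tu; elim: i => [|i IH]; first by rewrite add0n op0 //; apply: multipleT.
by rewrite addSn /= -!/(multiple _ _) IH opA //; apply: multipleT.
Qed.

Lemma multipleM i j u : T u -> multiple j (multiple i u) = multiple (j * i) u.
Proof.
move=> Tu; elim: j => [|j IH] //.
by rewrite mulSn multipleD //= -!/(multiple _ _) IH.
Qed.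

Lemma multipleS_lt i u : T u -> o < u -> multiple i u < b ->
  multiple i u < multiple i.+1 u.
Proof.
move=> Tu ou ib /=; rewrite -!/(multiple _ _) -{1}(op0 (multipleT i Tu)).
by apply: op_lt => //; rewrite ?op0 //; apply: multipleT.
Qed.

Lemma multiple_leS i j u : T u -> (i <= j)%N -> multiple i u <= multiple j u.
Proof.
move=> Tu /subnK <-; rewrite multipleD // -{1}(op0 (multipleT i Tu)).
have /andP[? ?] := multipleT (j - i) Tu.
by apply: op_le => //; apply: multipleT.
Qed.

Lemma multiple_lt i j u : T u -> o < u -> multiple i u < b -> (i < j)%N ->
  multiple i u < multiple j u.
Proof.
move=> Tu ou ib ij; apply: (lt_le_trans (multipleS_lt Tu ou ib)).
exact: multiple_leS.
Qed.

(** The value [g x] is the supremum of the dyadic numbers [j / 2 ^ k] such that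
    [j] copies of the [k]-th half of a unit [c] fit into [x].  Additivity holds
    up to [2 / 2 ^ k] for every [k]; strictness needs that the halves of [c] go
    below any point above [o].  The last clause keeps sums of boundedly many
    small elements in the range where [g] is additive. *)
Theorem truncated_semigroup_scale : exists (c : R) (g : R -> R),
  [/\ o < c < b,
      forall x y, T x -> T y -> op x y < c -> g (op x y) = g x + g y,
      forall x y, T x -> T y -> x < y -> y < c -> g x < g y &
      forall N, exists d, [/\ T d, o < d & multiple N d < c]].
Proof.
(* A unit strictly below [b]: its multiples in use are not cut off. *)
pose c := (o + b) / 2.
have [oc cb] : o < c /\ c < b by rewrite /c !midf_lt.
have ex_half x : exists h, T x -> T h /\ op h h = x.
  by case: (pselect (T x)) => [/op_half[h]|?]; [exists h | exists 0].
have [hf hfP] := choice ex_half.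
pose u k := iter k hf c.
have uT k : T (u k).
  elim: k => [|k /hfP[]//].
  by rewrite /T /u /= !ltW.
have uS k : op (u k.+1) (u k.+1) = u k by have [] := hfP _ (uT k).
have uo k : o < u k.
  elim: k => [|k IH] //; have /andP[ou _] := uT k.+1.
  rewrite lt_neqAle ou andbT; apply/eqP => E.
  by move: (uS k); rewrite -E op0 // => E'; move: IH; rewrite -E' ltxx.
have u2 k m : multiple (2 ^ m) (u (m + k)%N) = u k.
  elim: m k => [|m IH] k; first by rewrite multiple1.
  rewrite expnS mulnC -multipleM // -[in RHS]IH addSn; congr multiple.
  by rewrite -[2%N]/(1 + 1)%N multipleD // multiple1 // uS.
(* Two multiples are compared at their common level of halving. *)
have compare j k l m x : multiple j (u k) <= x -> x <= multiple l (u m) ->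
    x < c -> j%:R / 2 ^+ k <= l%:R / 2 ^+ m :> R.
  rewrite -(u2 k m) -(u2 m k) [(k + m)%N]addnC !multipleM // => jx xl xc.
  rewrite ler_pdivrMr ?exprn_gt0 // mulrAC ler_pdivlMr ?exprn_gt0 //.
  rewrite -!natrX -!natrM ler_nat leqNgt; apply/negP => lj.
  have le := multiple_leS (uT (m + k)%N) (ltnW lj).
  have lb : multiple (l * 2 ^ k) (u (m + k)%N) < b.
    by apply: (le_lt_trans le); apply: (le_lt_trans jx); apply: (lt_trans xc).
  have := multiple_lt (uT _) (uo _) lb lj.
  by rewrite ltNge (le_trans jx).
have floor k x : T x -> x < c ->
    exists j, multiple j (u k) <= x < multiple j.+1 (u k).
  move=> /andP[ox _] xc.
  have ex : exists i, x < multiple i (u k).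
    by exists (2 ^ k)%N; have := u2 0 k; rewrite addn0 => ->.
  case: (ex_minnP ex) => -[|i]; first by rewrite /= ltNge ox.
  move=> xi mini; exists i; rewrite xi andbT leNgt; apply/negP => /mini.
  by rewrite ltnn.
pose S x : set R := [set q | exists j k, q = j%:R / 2 ^+ k /\ multiple j (u k) <= x].
pose g x := sup (S x).
have S0 x : T x -> S x !=set0.
  by move=> /andP[ox _]; exists 0; exists 0, 0; rewrite mul0r.
have Sub x l m : x < c -> x <= multiple l (u m) -> ubound (S x) (l%:R / 2 ^+ m).
  by move=> xc xl _ [j [k [-> jx]]]; apply: compare jx xl xc.
have gub x l m : T x -> x < c -> x <= multiple l (u m) -> g x <= l%:R / 2 ^+ m.
  by move=> Tx xc xl; apply: ge_sup; [exact: S0|exact: Sub].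
have glb x j k : T x -> x < c -> multiple j (u k) <= x -> j%:R / 2 ^+ k <= g x.
  move=> Tx xc jx; apply: ub_le_sup; last by exists j, k.
  have [l /andP[_ /ltW xl]] := floor 0 x Tx xc.
  by exists (l.+1%:R / 2 ^+ 0); apply: Sub.
have gD x y : T x -> T y -> op x y < c -> g (op x y) = g x + g y.
  move=> Tx Ty xyc.
  have [/andP[ox _] /andP[oy _]] := (Tx, Ty).
  have xc : x < c.
    by apply: le_lt_trans xyc; rewrite -{1}(op0 Tx) (opC Tx) //; apply: op_le.
  have yc : y < c.
    by apply: le_lt_trans xyc; rewrite -{1}(op0 Ty); apply: op_le.
  suff near_eq k : `|g (op x y) - (g x + g y)| <= 2 / 2 ^+ k.
    apply/eqP; rewrite -subr_eq0 -normr_le0; apply/ler_addgt0Pr => e e0.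
    rewrite add0r.
    have e20 : 0 < e / 2 by rewrite divr_gt0.
    have [k _ /(_ k (leqnn k)) /= ke] := near_infty_natSinv_expn_lt (PosNum e20).
    apply: (le_trans (near_eq k)); rewrite mulrC -ler_pdivlMr //.
    by rewrite -[_^-1]mul1r ltW.
  have [i /andP[ix xi]] := floor k x Tx xc.
  have [j /andP[jy yj]] := floor k y Ty yc.
  have Tm l : T (multiple l (u k)) by exact: multipleT.
  have lo : (i + j)%:R / 2 ^+ k <= g (op x y).
    apply: glb => //; first exact: opT.
    rewrite multipleD //; apply: (@le_trans _ _ (op x (multiple j (u k)))).
      exact: op_le.
    exact: op_ler.
  have up : g (op x y) <= (i.+1 + j.+1)%:R / 2 ^+ k.
    apply: gub => //; first exact: opT.
    rewrite multipleD //; apply: (@le_trans _ _ (op x (multiple j.+1 (u k)))).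
      by apply: op_ler => //; apply: ltW.
    by apply: op_le => //; apply: ltW.
  have := glb x i k Tx xc ix; have := gub x i.+1 k Tx xc (ltW xi).
  have := glb y j k Ty yc jy; have := gub y j.+1 k Ty yc (ltW yj).
  move: lo up; rewrite !natrD -!natr1 !mulrDl mul1r ler_norml.
  by move=> *; apply/andP; split; lra.
have small z : o < z -> exists k, u k < z.
  (* Otherwise the greatest lower bound of [u] is an idempotent above [o]. *)
  move=> oz; apply: contrapT => /forallNP Nu.
  pose A := [set x | T x /\ forall k, x <= u k].
  have Ao : A o by split=> // k; apply: ltW.
  have bA : has_ubound A by exists (u 0); move=> x [_]; exact.
  have os : o <= sup A by apply: ub_le_sup.
  have su k : sup A <= u k.
    by apply: ge_sup; [exists o | move=> x [_]; exact].
  have Ts : T (sup A) by rewrite /T os (le_trans (su 0)) // ltW.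
  have ss : op (sup A) (sup A) <= sup A.
    apply: ub_le_sup => //; split; first exact: opT.
    move=> k; rewrite -uS; apply: (@le_trans _ _ (op (sup A) (u k.+1))).
      exact: op_ler.
    exact: op_le.
  have zs : z <= sup A.
    have zu k : z <= u k by rewrite leNgt; apply/negP/Nu.
    apply: ub_le_sup => //; split=> //.
    by rewrite /T (ltW oz) (le_trans (zu 0)) // ltW.
  have := op_lt To Ts Ts (lt_le_trans oz zs).
  rewrite op0 // => /(_ (le_lt_trans (su 0) cb)).
  by rewrite ltNge ss.
exists c, g; split => // [|x y Tx Ty xy yc|N]; first by rewrite oc.
  have [z [Tz xzy]] := op_sub Tx Ty (ltW xy).
  rewrite -xzy gD ?xzy // ltrDl.
  have oz : o < z.
    have /andP[oz _] := Tz; rewrite lt_neqAle oz andbT; apply/eqP => E.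
    by move: xy; rewrite -xzy -E (opC Tx) // op0 // ltxx.
  have [k /ltW ku] := small z oz.
  have zc : z < c.
    apply: le_lt_trans yc; rewrite -xzy -{1}(op0 Tz); apply: op_le => //.
    by have /andP[] := Tx.
  apply: (@lt_le_trans _ _ (1%:R / 2 ^+ k)); first by rewrite divr_gt0 ?exprn_gt0.
  by apply: glb => //; rewrite multiple1.
exists (u N); split => //.
have E : multiple (2 ^ N) (u N) = c by have := u2 0 N; rewrite addn0.
have NN : (N < 2 ^ N)%N by apply: ltn_expl.
rewrite -E; apply: multiple_lt => //.
by apply: (le_lt_trans (multiple_leS _ (ltnW NN))) => //; rewrite E.
Qed.
End TruncatedSemigroup.

(** * Coordinatewise increasing means *)

Definition upd {R : realType} {J : Type} (A : pred J) (t : R) (v : J -> R) k :=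
  if A k then t else v k.

(** Reflexive CM-functions in coordinate form.  Of continuity only this is kept:
    the intermediate value property along segments on which a block of
    coordinates moves together. *)
Record cm_mean {R : realType} {J : finType} (I : set R) (G : (J -> R) -> R) : Prop :=
  CmMean {
    cm_in : forall v, (forall k, I (v k)) -> I (G v);
    cm_lt : forall v w, (forall k, I (v k)) -> (forall k, I (w k)) ->
      (forall k, v k <= w k) -> (exists k, v k < w k) -> G v < G w;
    cm_const : forall t, I t -> G (fun=> t) = t;
    cm_ivt : forall (A : pred J) p q c v, I p -> I q -> p <= q ->
      (forall k, I (v k)) -> G (upd A p v) <= c <= G (upd A q v) ->
      exists t, p <= t <= q /\ G (upd A t v) = c
  }.

Section CmMeanTheory.
Context {R : realType} {J : finType} (I : set R) (G : (J -> R) -> R).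
Hypothesis HG : cm_mean I G.
Implicit Types (v w : J -> R) (A : pred J).

Lemma cm_le v w : (forall k, I (v k)) -> (forall k, I (w k)) ->
  (forall k, v k <= w k) -> G v <= G w.
Proof.
move=> Iv Iw vw; have [/(cm_lt HG Iv Iw vw)/ltW//|Nex] := pselect (exists k, v k < w k).
suff -> : v = w by [].
apply/funext => k; apply/eqP; rewrite eq_le vw leNgt /=.
by apply/negP => vwk; apply: Nex; exists k.
Qed.

Lemma cm_between v a c : (forall k, I (v k)) -> I a -> I c ->
  (forall k, a <= v k <= c) -> a <= G v <= c.
Proof.
move=> Iv Ia Ic vac; rewrite -{1}(cm_const HG Ia) -{1}(cm_const HG Ic).
by apply/andP; split; apply: cm_le => // k; have /andP[] := vac k.
Qed.

Lemma updI A t v : I t -> (forall k, I (v k)) -> forall k, I (upd A t v k).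
Proof. by move=> It Iv k; rewrite /upd; case: ifP. Qed.

Lemma upd_lt A s t v : I s -> I t -> (forall k, I (v k)) -> (exists k, A k) ->
  s < t -> G (upd A s v) < G (upd A t v).
Proof.
move=> Is It Iv [k Ak] st; apply: (cm_lt HG); try exact: updI.
  by move=> l; rewrite /upd; case: ifP => // _; apply: ltW.
by exists k; rewrite /upd Ak.
Qed.

Lemma upd_le A s t v : I s -> I t -> (forall k, I (v k)) ->
  s <= t -> G (upd A s v) <= G (upd A t v).
Proof.
move=> Is It Iv st; apply: cm_le; try exact: updI.
by move=> l; rewrite /upd; case: ifP.
Qed.

Lemma upd_inj A s t v : I s -> I t -> (forall k, I (v k)) -> (exists k, A k) ->
  G (upd A s v) = G (upd A t v) -> s = t.
Proof.
move=> Is It Iv exA E; have [st|ts|//] := ltgtP s t.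
  by have := upd_lt Is It Iv exA st; rewrite E ltxx.
by have := upd_lt It Is Iv exA ts; rewrite E ltxx.
Qed.

Lemma upd_leP A s t v : I s -> I t -> (forall k, I (v k)) -> (exists k, A k) ->
  (G (upd A s v) <= G (upd A t v)) = (s <= t).
Proof.
move=> Is It Iv exA; apply/idP/idP => [|st]; last exact: upd_le.
by apply: contraTT; rewrite -!ltNge; apply: upd_lt.
Qed.

Lemma upd_cst_gt A lo hi : I lo -> I hi -> lo < hi -> (exists k, A k) ->
  lo < G (upd A hi (fun=> lo)).
Proof.
move=> Ilo Ihi lohi exA; have := upd_lt Ilo Ihi (fun=> Ilo) exA lohi.
have -> : upd A lo (fun=> lo) = fun=> lo by apply/funext => k; rewrite /upd if_same.
by rewrite (cm_const HG).
Qed.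

Lemma upd_cst_lt A lo hi : I lo -> I hi -> lo < hi -> (exists k, ~~ A k) ->
  G (upd A hi (fun=> lo)) < hi.
Proof.
move=> Ilo Ihi lohi [k Ak]; rewrite -[ltRHS](cm_const HG Ihi).
apply: (cm_lt HG) => //; first exact: updI.
  by move=> l; rewrite /upd; case: ifP => // _; apply: ltW.
by exists k; rewrite /upd (negbTE Ak).
Qed.

Lemma upd_predC A (lo hi : R) :
  upd A lo (fun=> hi) = upd (predC A) hi (fun=> lo).
Proof. by apply/funext => k; rewrite /upd /=; case: (A k). Qed.

Lemma upd_cst_between A x c lo hi : I lo -> I hi -> lo <= x <= hi ->
  lo <= c <= hi -> I x -> I c -> lo <= G (upd A x (fun=> c)) <= hi.
Proof.
move=> Ilo Ihi xb cb Ix Ic; apply: cm_between => //; first exact: updI.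
by move=> k; rewrite /upd; case: ifP.
Qed.

End CmMeanTheory.

(** * A local scale for the Gauss composition *)

Section LocalScale.
Context {R : realType} {n : nat} (I : set R).
Notation J := 'I_n.+2.
Variables (M K : (J -> R) -> R).
Hypothesis intI : is_interval I.
Hypothesis HM : cm_mean I M.
Hypothesis HK : cm_mean I K.
Hypothesis Kcyc : forall (a : J) (v : J -> R), (forall k, I (v k)) ->
  K (fun k => v (k + a)) = K v.
Hypothesis bis : forall Y : J -> J -> R, (forall i k, I (Y i k)) ->
  K (fun i => M (fun k => Y i k)) = K (fun j => M (fun k => Y (k - j) k)).

Variables (o t : R).
Hypothesis Io : I o.
Hypothesis It : I t.
Hypothesis ot : o < t.

(* On [o, b] the equations [tau 0 a = x] and [tau (- 1) c = y] are solvable. *)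
Let tau (j : J) x := M (upd (pred1 j) x (fun=> o)).
Let kap x := K (upd (pred1 0) x (fun=> o)).
Let K2 x y := K (upd (pred1 0) x (upd (pred1 1) y (fun=> o))).
Let b := Num.min (tau 0 t) (tau (- 1) t).
Let T x := o <= x <= b.

Let updo A : upd A o (fun _ : J => o) = fun=> o.
Proof. by apply/funext => k; rewrite /upd if_same. Qed.

Let ex1 (j : J) : exists k, pred1 j k. Proof. by exists j => /=. Qed.

Let tauo j : tau j o = o. Proof. by rewrite /tau updo (cm_const HM). Qed.

Let Iot x : o <= x <= t -> I x. Proof. exact: intI. Qed.

Let taut j : o < tau j t.
Proof. by rewrite -{1}(tauo j); apply: (upd_lt HM). Qed.

Let ob : o < b. Proof. by rewrite lt_min !taut. Qed.

Let bt : b <= t.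
Proof.
rewrite ge_min; apply/orP; left; rewrite -[leRHS](cm_const HM It).
apply: (cm_le HM) => //; first exact: updI.
by move=> k; rewrite /upd; case: ifP => // _; apply: ltW.
Qed.

Let IT x : T x -> I x.
Proof. by move=> /andP[ox xb]; apply: Iot; rewrite ox (le_trans xb). Qed.

Let To : T o. Proof. by rewrite /T lexx ltW. Qed.
Let Tb : T b. Proof. by rewrite /T lexx ltW. Qed.

Let tau_onto (j : J) x : j = 0 \/ j = - 1 -> T x -> exists a, I a /\ tau j a = x.
Proof.
move=> j01 /andP[ox xb]; have ot' := ltW ot.
have xj : x <= tau j t.
  by apply: (le_trans xb); case: j01 => ->; rewrite ge_min lexx ?orbT.
have [|a [/Iot Ia E]] := cm_ivt HM (A := pred1 j) (c := x) Io It ot' (fun=> Io).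
  by rewrite -/(tau _ _) -/(tau _ _) tauo ox.
by exists a.
Qed.

(** Bisymmetry for a matrix that differs from [o] only in slot 0, whose column
    it reverses. *)
Let K_reverse (x : J -> R) : (forall k, T (x k)) -> K (fun k => x (- k)) = K x.
Proof.
move=> Tx; have [a aP] := choice (fun k => tau_onto (or_introl erefl) (Tx k)).
have Ia k : I (a k) by have [] := aP k.
have := bis (Y := fun i => upd (pred1 0) (a i) (fun=> o)) (fun i => updI _ (Ia i) (fun=> Io)).
have -> : (fun i => M (upd (pred1 0) (a i) (fun=> o))) = x.
  by apply/funext => i; have [] := aP i.
move=> ->; congr K; apply/funext => j; have [_ <-] := aP (- j).
by congr M; apply/funext => k; rewrite /upd /=; case: eqP => // ->; rewrite sub0r.
Qed.

Let P a c := M (upd (pred1 0) a (upd (pred1 (- 1)) c (fun=> o))).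

Let m1_neq0 : (- 1 : J) == 0 = false. Proof. by rewrite oppr_eq0 oner_eq0. Qed.

(** Bisymmetry for a matrix with entries [a i] in slot 0, one entry [c] in slot
    [- 1] of row 0, and [o] elsewhere.  Read by rows, [c] is paired with [a 0];
    read by columns it is paired with [a 1], and the column order is undone by
    [K_reverse]. *)
Let K_exchange_raw (x : J -> R) a0 a1 c : (forall k, T (x k)) -> I a0 -> I a1 -> I c ->
  tau 0 a0 = x 0 -> tau 0 a1 = x 1 -> T (P a1 c) ->
  K (upd (pred1 0) (P a0 c) x) = K (upd (pred1 1) (P a1 c) x).
Proof.
move=> Tx Ia0 Ia1 Ic x0 x1 TP.
have [a aP] := choice (fun k => tau_onto (or_introl erefl) (Tx k)).
have a0E : a 0 = a0.
  apply: (upd_inj HM (A := pred1 0) _ Ia0 (fun=> Io)) => //; first by have [] := aP 0.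
  by rewrite -/(tau _ _) -/(tau _ _) x0; have [] := aP 0.
have a1E : a 1 = a1.
  apply: (upd_inj HM (A := pred1 0) _ Ia1 (fun=> Io)) => //; first by have [] := aP 1.
  by rewrite -/(tau _ _) -/(tau _ _) x1; have [] := aP 1.
pose Y (i k : J) := if k == 0 then a i else if (k == - 1) && (i == 0) then c else o.
have IY i k : I (Y i k).
  by rewrite /Y; case: ifP => _; [have [] := aP i | case: ifP].
rewrite -[RHS]K_reverse; last by move=> k; rewrite /upd; case: ifP.
have rows : upd (pred1 0) (P a0 c) x = fun i => M (Y i).
  apply/funext => i; rewrite {1}/upd /=; case: eqP => [->|/eqP i0].
    congr M; apply/funext => k; rewrite /Y /upd /= a0E eqxx.
    by case: eqP => //; rewrite andbT; case: eqP.
  have [_ <-] := aP i; congr M; apply/funext => k.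
  by rewrite /Y /upd /= (negbTE i0) andbF.
have cols : (fun k => upd (pred1 1) (P a1 c) x (- k)) = fun j => M (fun k => Y (k - j) k).
  apply/funext => i; rewrite {1}/upd /=; case: eqP => [i1|/eqP i1].
    congr M; apply/funext => k; rewrite /Y /upd /=.
    case: eqP => [->|_]; first by rewrite sub0r i1.
    have -> : (k - i == 0) = (k == - 1) by rewrite -i1 opprK subr_eq0.
    by rewrite andbb; case: eqP.
  have [_ <-] := aP (- i); congr M; apply/funext => k; rewrite /Y /upd /=.
  case: eqP => [->|_]; first by rewrite sub0r.
  case: ifP => // /andP[/eqP ->]; rewrite subr_eq0 => /eqP E.
  by move: i1; rewrite -E opprK eqxx.
by rewrite rows cols; exact: bis.
Qed.

(** So [P a c] is the sum of [tau 0 a] and [tau (- 1) c] for the addition defined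
    by [kap (x + y) = K2 x y]. *)
Let kapP a c : I a -> I c -> T (tau 0 a) -> T (tau (- 1) c) ->
  kap (P a c) = K2 (tau 0 a) (tau (- 1) c).
Proof.
move=> Ia Ic Ta Tc.
have Tx (k : J) : T (upd (pred1 0) (tau 0 a) (fun=> o) k).
  by rewrite /upd; case: ifP.
have Po : P o c = tau (- 1) c.
  congr M; apply/funext => k; rewrite /upd /=; case: eqP => // ->.
  by rewrite eq_sym m1_neq0.
have [x0 x1] : upd (pred1 0) (tau 0 a) (fun=> o) (0 : J) = tau 0 a /\
    upd (pred1 0) (tau 0 a) (fun=> o) (1 : J) = o.
  by [].
have := K_exchange_raw Tx Ia Io Ic; rewrite x0 x1 Po tauo.
move=> /(_ erefl erefl Tc) E.
transitivity (K (upd (pred1 0) (P a c) (upd (pred1 0) (tau 0 a) (fun=> o)))).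
  by congr K; apply/funext => k; rewrite /upd /=; case: eqP.
rewrite E; congr K; apply/funext => k; rewrite /upd /=.
by case: eqP => // ->; rewrite oner_eq0.
Qed.

Let kap_le u v : I u -> I v -> (kap u <= kap v) = (u <= v).
Proof. by move=> Iu Iv; apply: (upd_leP HK Iu Iv (fun=> Io) (ex1 0)). Qed.

Let kap_inj u v : I u -> I v -> kap u = kap v -> u = v.
Proof. by move=> Iu Iv; apply: (upd_inj HK Iu Iv (fun=> Io) (ex1 0)). Qed.

Let PI a c : I a -> I c -> I (P a c).
Proof. by move=> Ia Ic; apply: (cm_in HM); apply: updI => //; apply: updI. Qed.

(** If [w] is [x 0 + y] and [w'] is [x 1 + y], the summand [y] may sit in either
    argument. *)
Let K_exchange (x : J -> R) y w w' : (forall k, T (x k)) -> T y -> I w -> T w' ->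
  kap w = K2 (x 0) y -> kap w' = K2 (x 1) y ->
  K (upd (pred1 0) w x) = K (upd (pred1 1) w' x).
Proof.
move=> Tx Ty Iw Tw' wE w'E.
have [a0 [Ia0 a0E]] := tau_onto (or_introl erefl) (Tx 0).
have [a1 [Ia1 a1E]] := tau_onto (or_introl erefl) (Tx 1).
have [c [Ic cE]] := tau_onto (or_intror erefl) Ty.
have wP : w = P a0 c.
  by apply: kap_inj => //; [exact: PI|rewrite wE kapP ?a0E ?cE].
have w'P : w' = P a1 c.
  apply: kap_inj; [exact: IT|exact: PI|].
  by rewrite w'E kapP ?a1E ?cE.
by rewrite wP w'P; apply: K_exchange_raw => //; rewrite -w'P.
Qed.

Let shift_eq0 (j k : J) : (k + j == j) = (k == 0).
Proof. by rewrite -{2}[j]add0r (inj_eq (addIr j)). Qed.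

Let K_single (j : J) x : I x -> K (upd (pred1 j) x (fun=> o)) = kap x.
Proof.
move=> Ix; rewrite -(Kcyc j); last by apply: updI.
by congr K; apply/funext => k; rewrite /upd /= shift_eq0.
Qed.

Let K2or x : K2 x o = kap x. Proof. by rewrite /K2 updo. Qed.

Let K2ol x : I x -> K2 o x = kap x.
Proof.
move=> Ix; rewrite -(K_single 1 Ix); congr K; apply/funext => k.
by rewrite /upd /=; case: eqP => // ->.
Qed.

Let K2_ler x y z : I x -> I y -> I z -> x <= y -> K2 z x <= K2 z y.
Proof.
move=> Ix Iy Iz xy; apply: (cm_le HK); try by do 2?apply: updI.
by move=> k; rewrite /upd; case: ifP => // _; case: ifP.
Qed.

Let K2_lel x y z : I x -> I y -> I z -> x <= y -> K2 x z <= K2 y z.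
Proof. by move=> Ix Iy Iz; apply: (upd_le HK) => //; apply: updI. Qed.

Let K2_ltl x y z : I x -> I y -> I z -> x < y -> K2 x z < K2 y z.
Proof. by move=> Ix Iy Iz; apply: (upd_lt HK) => //; apply: updI. Qed.

(* The minimum cuts the addition off at [b], which makes it total on [o, b]. *)
Let op_ex (xy : R * R) : exists z, T xy.1 -> T xy.2 ->
  T z /\ kap z = Num.min (kap b) (K2 xy.1 xy.2).
Proof.
case: xy => x y /=; have [Tx|] := pselect (T x); last by exists 0.
have [Ty|] := pselect (T y); last by exists 0.
have [|z [Tz zE]] := cm_ivt HK (A := pred1 0) (c := Num.min (kap b) (K2 x y))
  (IT To) (IT Tb) (ltW ob) (fun=> IT To); last by exists z.
rewrite -/(kap _) -/(kap _) ge_min lexx andbT le_min (kap_le (IT To) (IT Tb)) (ltW ob) /=.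
rewrite -K2or; apply: (@le_trans _ _ (K2 x o)).
  by apply: K2_lel; try exact: IT; have /andP[] := Tx.
by apply: K2_ler; try exact: IT; have /andP[] := Ty.
Qed.

Let op x y := projT1 (choice op_ex) (x, y).

Let opP x y : T x -> T y -> T (op x y) /\ kap (op x y) = Num.min (kap b) (K2 x y).
Proof. by rewrite /op; case: (choice op_ex) => f /= /(_ (x, y)). Qed.

Let opT x y : T x -> T y -> T (op x y).
Proof. by move=> Tx Ty; have [] := opP Tx Ty. Qed.

Let op_small x y : T x -> T y -> K2 x y <= kap b -> kap (op x y) = K2 x y.
Proof. by move=> Tx Ty xyb; have [_ ->] := opP Tx Ty; apply/min_idPr. Qed.

Let op_large x y : T x -> T y -> kap b <= K2 x y -> op x y = b.
Proof.
move=> Tx Ty bxy; have [Txy E] := opP Tx Ty.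
by apply: kap_inj; [exact: IT|exact: IT|rewrite E; apply/min_idPl].
Qed.

Let op_lt_small x y : T x -> T y -> op x y < b -> K2 x y < kap b.
Proof.
by move=> Tx Ty; apply: contraTT; rewrite -!leNgt => /(op_large Tx Ty) ->.
Qed.

Let op0 x : T x -> op o x = x.
Proof.
move=> Tx; apply: kap_inj; [by apply: IT; apply: opT|exact: IT|].
by rewrite op_small ?K2ol ?kap_le //; try exact: IT; have /andP[] := Tx.
Qed.

Let op_le x y z : T x -> T y -> T z -> x <= y -> op x z <= op y z.
Proof.
move=> Tx Ty Tz xy; rewrite -kap_le; try by apply: IT; apply: opT.
have [_ ->] := opP Tx Tz; have [_ ->] := opP Ty Tz.
by rewrite le_min !ge_min lexx /= K2_lel ?orbT //; exact: IT.
Qed.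

Let op_lt x y z : T x -> T y -> T z -> x < y -> op x z < b -> op x z < op y z.
Proof.
move=> Tx Ty Tz xy xzb; rewrite ltNge -kap_le; try by apply: IT; apply: opT.
have xz := op_lt_small Tx Tz xzb.
rewrite (op_small Tx Tz (ltW xz)) -ltNge; have [_ ->] := opP Ty Tz.
by rewrite lt_min xz K2_ltl //; exact: IT.
Qed.

(** The exchange identity with [o] in argument 0. *)
Let K2C_small x y : T x -> T y -> K2 x y <= kap b -> K2 y x = K2 x y.
Proof.
move=> Tx Ty xyb.
have Tv (k : J) : T (upd (pred1 1) x (fun=> o) k) by rewrite /upd; case: ifP.
have [v0 v1] : upd (pred1 1) x (fun=> o) (0 : J) = o /\
  upd (pred1 1) x (fun=> o) (1 : J) = x by [].
have := K_exchange Tv Ty (IT Ty) (opT Tx Ty).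
rewrite v0 v1 (K2ol (IT Ty)) (op_small Tx Ty xyb).
move=> /(_ erefl erefl) E; rewrite [LHS]E -(op_small Tx Ty xyb) -(K_single 1).
  by congr K; apply/funext => k; rewrite /upd /=; case: eqP.
by apply: IT; apply: opT.
Qed.

Let opC x y : T x -> T y -> op x y = op y x.
Proof.
move=> Tx Ty; apply: kap_inj; try by apply: IT; apply: opT.
have [_ ->] := opP Tx Ty; have [_ ->] := opP Ty Tx.
have [/(K2C_small Tx Ty) -> //|] := boolP (K2 x y <= kap b).
have [/(K2C_small Ty Tx) -> //|] := boolP (K2 y x <= kap b).
by rewrite -!ltNge => /ltW yxb /ltW xyb; rewrite !min_l.
Qed.

Let op_ler x y z : T x -> T y -> T z -> x <= y -> op z x <= op z y.
Proof. by move=> Tx Ty Tz xy; rewrite (opC Tz Tx) (opC Tz Ty) op_le. Qed.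

Let op_ge x y : T x -> T y -> x <= op y x.
Proof.
by move=> Tx Ty; rewrite -{1}(op0 Tx); apply: op_le => //; have /andP[] := Ty.
Qed.

Let op_eqb x : T x -> b <= x -> x = b.
Proof. by move=> /andP[_ xb] bx; apply/eqP; rewrite eq_le xb. Qed.

(** When nothing is cut off this is the exchange identity for the arguments [x]
    and [z]; otherwise both sides are [b], by monotonicity. *)
Let opAC x y z : T x -> T y -> T z -> op (op x y) z = op x (op z y).
Proof.
move=> Tx Ty Tz; have Txy := opT Tx Ty; have Tzy := opT Tz Ty.
have [xyb|/ltW bxy] := leP (K2 x y) (kap b); last first.
  have xyE := op_large Tx Ty bxy.
  rewrite (op_eqb (opT Txy Tz)); last by rewrite xyE opC // op_ge.
  rewrite [RHS]op_eqb //; first exact: opT.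
  by rewrite -[leLHS]xyE; apply: op_ler => //; apply: op_ge.
have [zyb|/ltW bzy] := leP (K2 z y) (kap b); last first.
  have zyE := op_large Tz Ty bzy.
  rewrite (op_eqb (opT Txy Tz)); last first.
    by rewrite -[leLHS]zyE (opC Tz Ty); apply: op_le => //; apply: op_ge.
  by rewrite [RHS]op_eqb //; [exact: opT | rewrite zyE; apply: op_ge].
pose v : J -> R := upd (pred1 0) x (upd (pred1 1) z (fun=> o)).
have Tv k : T (v k) by rewrite /v /upd; case: ifP => // _; case: ifP.
have [v0 v1] : v 0 = x /\ v 1 = z by [].
have := K_exchange Tv Ty (IT Txy) Tzy; rewrite v0 v1 !op_small //.
move=> /(_ erefl erefl) E.
suff K2E : K2 (op x y) z = K2 x (op z y).
  apply: kap_inj; try by apply: IT; do ?apply: opT.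
  by have [_ ->] := opP Txy Tz; have [_ ->] := opP Tx Tzy; rewrite K2E.
transitivity (K (upd (pred1 0) (op x y) v)).
  by congr K; apply/funext => k; rewrite /v /upd /=; case: eqP.
rewrite E; congr K; apply/funext => k; rewrite /v /upd /=.
by case: eqP => // ->.
Qed.

Let opA x y z : T x -> T y -> T z -> op x (op y z) = op (op x y) z.
Proof. by move=> Tx Ty Tz; rewrite opAC // (opC Ty Tz). Qed.

Let op_half x : T x -> exists h, T h /\ op h h = x.
Proof.
move=> Tx; have /andP[ox xb] := Tx; have Ix := IT Tx.
have E h : upd (pred2 0 1) h (fun=> o) = upd (pred1 (0 : J)) h (upd (pred1 1) h (fun=> o)).
  by apply/funext => k; rewrite /upd /=; case: eqP.
have [|h [/andP[oh hx] hE]] := cm_ivt HK (A := pred2 0 1) (c := kap x) Io Ix ox (fun=> Io).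
  rewrite !E -!/(K2 _ _) K2or kap_le // ox /= -K2ol //.
  by apply: K2_lel.
have Th : T h by rewrite /T oh (le_trans hx).
exists h; split=> //; apply: kap_inj; [by apply: IT; apply: opT|by []|].
by move: hE; rewrite E -/(K2 _ _) => hE; rewrite op_small // hE kap_le //; exact: IT.
Qed.

Let op_sub x y : T x -> T y -> x <= y -> exists z, T z /\ op x z = y.
Proof.
move=> Tx Ty xy; have [/andP[ox xb] /andP[oy yb]] := (Tx, Ty).
have [Ix Iy] := (IT Tx, IT Ty).
have E z : upd (pred1 1) z (upd (pred1 (0 : J)) x (fun=> o)) =
    upd (pred1 0) x (upd (pred1 1) z (fun=> o)).
  apply/funext => k; rewrite /upd /=.
  by case: eqP => // ->.
have [|z [/andP[oz zb] zE]] := cm_ivt HK (A := pred1 1) (c := kap y) Io Iy oy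
    (v := upd (pred1 (0 : J)) x (fun=> o)) (updI _ Ix (fun=> Io)).
  by rewrite !E -!/(K2 _ _) K2or kap_le // xy /= -K2ol // K2_lel.
have Tz : T z by rewrite /T oz (le_trans zb).
exists z; split=> //; apply: kap_inj; [by apply: IT; apply: opT|by []|].
by move: zE; rewrite E -/(K2 _ _) => zE; rewrite op_small // zE kap_le //; exact: IT.
Qed.

(** An argument can be poured into the next one; cyclic invariance moves the
    exchange identity from the arguments 0 and 1 to [p] and [p + 1]. *)
Let K_merge (p : J) (v : J -> R) s : (forall k, T (v k)) -> T s -> v p = o ->
  op (v (p + 1)) s < b ->
  K (upd (pred1 p) s v) = K (upd (pred1 (p + 1)) (op (v (p + 1)) s) v).
Proof.
move=> Tv Ts vp lt; have Tpk k : T (v (k + p)) by [].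
have Tw := opT (Tv (p + 1)) Ts.
have := K_exchange Tpk Ts (IT Ts) Tw.
rewrite add0r vp K2ol ?[1 + p]addrC; last exact: IT.
rewrite op_small //; last by apply/ltW/op_lt_small.
move=> /(_ erefl erefl) E.
rewrite -(Kcyc p) -1?[RHS](Kcyc p); try by move=> k; apply: IT; rewrite /upd; case: ifP.
transitivity (K (upd (pred1 0) s (fun k => v (k + p)))).
  by congr K; apply/funext => k; rewrite /upd /= shift_eq0.
rewrite E; congr K; apply/funext => k; rewrite /upd /=.
by rewrite [k + p]addrC (inj_eq (addrI p)).
Qed.

(** Pouring the arguments one by one into the last one shows that [K v] depends
    only on the sum of the entries of [v].  The constant family [K v] has the
    same value under [K], hence the same sum: this is the averaging rule. *)
Theorem local_scale : exists (d : R) (g : R -> R),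
  [/\ o < d <= t,
      forall x y, o <= x -> y <= d -> x < y -> g x < g y &
      forall v, (forall k, o <= v k <= d) ->
        (\sum_k g (v k)) = g (K v) *+ n.+2].
Proof.
have [c [g [/andP[oc cb] gD g_lt small]]] :=
  truncated_semigroup_scale ob opT opC opA op0 op_le op_lt op_half op_sub.
have [d [Td od dc]] := small n.+2.
have [_ db] := andP Td.
pose m j := multiple o op j d.
have mT j : T (m j) by apply: (multipleT ob opT).
have mc j : (j <= n.+2)%N -> m j < c.
  by move=> jn; apply: (le_lt_trans _ dc); apply: (multiple_leS ob opT opA op0 op_le).
have dc' : d < c by rewrite -[d](multiple1 ob opC op0 Td); exact: (mc 1%N).
have total v : (forall k, o <= v k <= d) ->
    exists s, [/\ T s, K v = kap s & g s = \sum_k g (v k)].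
  move=> vd; have Tv k : T (v k).
    by have /andP[ov vkd] := vd k; rewrite /T ov (le_trans vkd).
  (* The arguments below [p] have been emptied into argument [p]. *)
  pose z p s (k : J) := if (k < p)%N then o else if k == p :> nat then s else v k.
  have partial p : (p < n.+2)%N -> exists s, [/\ T s, s <= m p.+1, K v = K (z p s) &
      g s = \sum_(k < p.+1) g (v (inord k))].
    elim: p => [_|p IH pn].
      exists (v 0); split => //.
      - by rewrite /m (multiple1 ob opC op0 Td); have /andP[] := vd 0.
      - congr K; apply/funext => k; rewrite /z ltn0.
        by case: eqP => // k0; congr v; apply/val_inj.
      - by rewrite big_ord_recl big_ord0 addr0; congr (g (v _)); apply/val_inj; rewrite /= inordK.
    have [s [Ts sm KE gE]] := IH (ltnW pn).
    pose x := z p o; pose q : J := inord p.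
    have q1 : q + 1 = inord p.+1.
      by apply/val_inj; rewrite /= !inordK ?(ltnW pn) // modnS /= addn1 modn_small.
    have xq : x q = o by rewrite /x /z inordK ?(ltnW pn) // ltnn eqxx.
    have xq1 : x (q + 1) = v (q + 1).
      by rewrite /x /z q1 inordK // ltnNge leqnSn /= gtn_eqF.
    have Tx k : T (x k) by rewrite /x /z; case: ifP => // _; case: ifP.
    have opm : op (v (q + 1)) s <= m p.+2.
      apply: (@le_trans _ _ (op d s)); first by apply: op_le => //; have /andP[] := vd (q + 1).
      exact: (op_ler Ts (mT p.+1) Td sm).
    have opc := le_lt_trans opm (mc _ pn).
    have := K_merge Tx Ts xq; rewrite xq1 => /(_ (lt_trans opc cb)) E.
    exists (op (v (q + 1)) s); split=> //; first exact: opT.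
    - rewrite KE; transitivity (K (upd (pred1 q) s x)).
        congr K; apply/funext => k; rewrite /upd /x /z /= -val_eqE /= inordK ?(ltnW pn) //.
        by case: ltngtP.
      rewrite E; congr K; apply/funext => k; rewrite /upd /x /z /= q1 -val_eqE /= inordK //.
      rewrite ltnS; have [kp|pk|kp] := ltngtP k p; last by rewrite kp ltn_eqF.
        by rewrite ltn_eqF // ltnS ltnW.
      by case: eqP.
    - by rewrite (gD _ _ (Tv _) Ts opc) gE [in RHS]big_ord_recr /= addrC q1.
  have [s [Ts _ KE gE]] := partial n.+1 (ltnSn _).
  exists s; split=> //.
    rewrite KE -(K_single ord_max); last exact: IT.
    congr K; apply/funext => k; rewrite /z /upd /= -val_eqE /=.
    have := ltn_ord k; rewrite ltnS leq_eqVlt => /orP[/eqP ->|kn].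
      by rewrite ltnn eqxx.
    by rewrite kn ltn_eqF.
  by rewrite gE; apply: eq_bigr => k _; rewrite inord_val.
exists d, g; split=> [|x y ox yd xy|v vd].
- by rewrite od (le_trans db).
- apply: g_lt => //; last exact: le_lt_trans dc'.
    by rewrite /T ox (le_trans (ltW xy)) // (le_trans yd).
  by rewrite /T (le_trans yd) // (le_trans ox) // ltW.
have Iv k : I (v k).
  by apply: IT; have /andP[ov vkd] := vd k; rewrite /T ov (le_trans vkd).
have Kvd := cm_between HK Iv Io (IT Td) vd.
have [s [Ts sE gs]] := total v vd.
have [r [Tr rE gr]] := total (fun=> K v) (fun=> Kvd).
have sr : s = r.
  by apply: kap_inj; try exact: IT; rewrite -sE -rE (cm_const HK) //; apply: (cm_in HK).
by rewrite -gs sr gr sumr_const card_ord.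
Qed.

End LocalScale.

(** * Means that are additive in some scale *)

(** Right continuity of [F] at [c] without any topology: the increments over the
    [n.+2] points [y j c x] add up to the increment over [x], so one of them is
    at most half of it, and iterating halves the increment indefinitely. *)
Lemma small_increment {R : realType} {n : nat} (D : set R) (F : R -> R)
    (y : 'I_n.+2 -> R -> R -> R) :
  (forall c x, D c -> D x -> c < x -> F c < F x) ->
  (forall c x j, D c -> D x -> c < x -> D (y j c x) /\ c < y j c x <= x) ->
  (forall c x, D c -> D x -> c < x -> \sum_j (F (y j c x) - F c) = F x - F c) ->
  forall c x e, D c -> D x -> c < x -> 0 < e ->
    exists z, [/\ D z, c < z <= x & F z < F c + e].
Proof.
move=> Flt yP yS c x e Dc Dx cx e0.
have iterated m : exists z, [/\ D z, c < z <= x & F z - F c <= (F x - F c) / 2 ^+ m].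
  elim: m => [|m [z [Dz /andP[cz zx] zm]]].
    by exists x; rewrite expr0 divr1 cx lexx.
  pose a := (F z - F c) / 2.
  have [j jP] : exists j, F (y j c z) - F c <= a.
    apply: contrapT => /forallNP large.
    have : a *+ n.+2 < F z - F c.
      have -> : a *+ n.+2 = \sum_(j < n.+2) a by rewrite sumr_const card_ord.
      rewrite -yS //; apply: ltr_sum => [|j _].
        by apply/hasP; exists ord0 => //; rewrite mem_index_enum.
      by rewrite ltNge; apply/negP/large.
    have a0 : 0 <= a by rewrite divr_ge0 // subr_ge0 ltW // Flt.
    rewrite -addn2 mulrnDr ltNge => /negP; apply.
    have -> : F z - F c = a *+ 2 by rewrite -mulr_natr /a divfK.
    by rewrite lerDr mulrn_wge0.
  have [Dy /andP[cy yz]] := yP c z j Dc Dz cz.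
  exists (y j c z); rewrite cy (le_trans yz) //; split=> //.
  by apply: (le_trans jP); rewrite /a exprSr invfM mulrA ler_pM2r.
have Fcx : 0 < F x - F c by rewrite subr_gt0 Flt.
have q0 : 0 < e / (F x - F c) by rewrite divr_gt0.
have [m _ /(_ m (leqnn m)) /= me] := near_infty_natSinv_expn_lt (PosNum q0).
have [z [Dz czx zm]] := iterated m; exists z; split=> //.
rewrite -ltrBlDl; apply: (le_lt_trans zm).
by rewrite mulrC -ltr_pdivlMr // -[_^-1]mul1r.
Qed.

Section MinMax.
Context {R : realType} {n : nat} (I : set R) (G : ('I_n.+2 -> R) -> R).
Hypothesis HG : cm_mean I G.

Lemma cm_minmax v : (forall k, I (v k)) ->
  exists i j, [/\ forall k, v i <= v k <= v j & v i <= G v <= v j].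
Proof.
move=> Iv.
have [i _ iP] := @arg_minP _ _ _ (ord0 : 'I_n.+2) predT v isT.
have [j _ jP] := @arg_maxP _ _ _ (ord0 : 'I_n.+2) predT v isT.
have vij k : v i <= v k <= v j by apply/andP; split; [exact: iP|exact: jP].
by exists i, j; split=> //; apply: (cm_between HG).
Qed.

Lemma cm_convex (D : set R) v : is_interval D -> D `<=` I ->
  (forall k, D (v k)) -> D (G v).
Proof.
move=> intD DI Dv; have [i [j [_]]] := cm_minmax (fun k => DI _ (Dv k)).
exact: intD.
Qed.

End MinMax.

Section AdditiveMean.
Context {R : realType} {n : nat} (I : set R).
Notation J := 'I_n.+2.
Variables (M K : (J -> R) -> R).
Hypothesis HM : cm_mean I M.
Hypothesis HK : cm_mean I K.

Definition cyclic_map (v : J -> R) (i : J) := M (fun k => v (k - i)).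

Variables (D : set R) (F : R -> R) (f : J -> R -> R).
Hypothesis intD : is_interval D.
Hypothesis DI : D `<=` I.
Hypothesis Flt : forall x y, D x -> D y -> x < y -> F x < F y.
Hypothesis FM : forall v, (forall k, D (v k)) -> F (M v) = \sum_k f k (v k).

Let ID x : D x -> I x. Proof. exact: DI. Qed.

Let updD A x c : D x -> D c -> forall k : J, D (upd A x (fun=> c) k).
Proof. by move=> Dx Dc k; rewrite /upd; case: ifP. Qed.

Lemma additive_sum x : D x -> F x = \sum_k f k x.
Proof. by move=> Dx; rewrite -FM // (cm_const HM) //; apply: DI. Qed.

Lemma additive_increment x c : D x -> D c ->
  forall j, f j x - f j c = F (M (upd (pred1 j) x (fun=> c))) - F c.
Proof.
move=> Dx Dc j; rewrite FM ?(additive_sum Dc); last exact: updD.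
rewrite (bigD1 j) //= [in RHS](bigD1 j (P := predT)) //= /upd /= eqxx.
rewrite [X in _ + X - _](eq_bigr (fun k => f k c)).
  by rewrite opprD addrACA subrr addr0.
by move=> k /negbTE ->.
Qed.

Let sum_increment x c : D x -> D c ->
  \sum_j (F (M (upd (pred1 j) x (fun=> c))) - F c) = F x - F c.
Proof.
move=> Dx Dc; rewrite (additive_sum Dx) [in RHS](additive_sum Dc) -sumrB.
by apply: eq_bigr => j _; rewrite additive_increment.
Qed.

Let updB j x c : D x -> D c -> c < x -> c < M (upd (pred1 j) x (fun=> c)) <= x.
Proof.
move=> Dx Dc cx; have [Ix Ic] := (ID Dx, ID Dc).
have /andP[_ ->] : c <= M (upd (pred1 j) x (fun=> c)) <= x.
  by apply: (upd_cst_between HM); rewrite ?lexx ?ltW.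
by rewrite (upd_cst_gt HM) //; exists j => /=.
Qed.

Let updB' j x c : D x -> D c -> x < c -> x <= M (upd (pred1 j) x (fun=> c)) < c.
Proof.
move=> Dx Dc xc; have [Ix Ic] := (ID Dx, ID Dc).
have /andP[-> _] : x <= M (upd (pred1 j) x (fun=> c)) <= c.
  by apply: (upd_cst_between HM); rewrite ?lexx ?ltW.
by rewrite upd_predC (upd_cst_lt HM) //; exists j; rewrite /= eqxx.
Qed.

Lemma additive_lt j x y : D x -> D y -> x < y -> f j x < f j y.
Proof.
move=> Dx Dy xy; rewrite -subr_gt0 additive_increment // subr_gt0.
have /andP[xM _] := updB j Dy Dx xy; apply: Flt => //.
by apply: (cm_convex HM) => //; apply: updD.
Qed.

Lemma additive_right_continuous c x e : D c -> D x -> c < x -> 0 < e ->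
  exists z, [/\ D z, c < z <= x & F z < F c + e].
Proof.
apply: (small_increment (y := fun j c x => M (upd (pred1 j) x (fun=> c)))) => //.
- by move=> {}c {}x j Dc Dx cx; split;
    [apply: (cm_convex HM) => //; exact: updD | exact: updB].
- by move=> {}c {}x Dc Dx _; apply: sum_increment.
Qed.

(** The reflection [z |-> - z] reduces this to continuity on the right. *)
Lemma additive_left_continuous c x e : D c -> D x -> x < c -> 0 < e ->
  exists z, [/\ D z, x <= z < c & F c - e < F z].
Proof.
move=> Dc Dx xc e0.
have [||||||//|z [/= Dz /andP[cz zx] zF]] := @small_increment _ n
  [set z | D (- z)] (fun z => - F (- z))
  (fun j c x => - M (upd (pred1 j) (- x) (fun=> - c))) _ _ _ (- c) (- x) e.
- by move=> u v /= Du Dv uv; rewrite ltrN2 Flt // ltrN2.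
- move=> u v j /= Du Dv uv; rewrite opprK; split.
    by apply: (cm_convex HM) => //; exact: updD.
  by rewrite ltrNr lerNl andbC; apply: updB' => //; rewrite ltrN2.
- move=> u v /= Du Dv uv; rewrite opprK [RHS]addrC -[RHS]opprB -sum_increment //.
  by rewrite -sumrN; apply: eq_bigr => j _; rewrite !opprK opprB addrC.
- by rewrite /= opprK.
- by rewrite /= opprK.
- by rewrite ltrN2.
exists (- z); split=> //; first by rewrite lerNr ltrNl zx cz.
by move: zF; rewrite opprK ltrNl opprD opprK.
Qed.

Let F_le x y : D x -> D y -> x <= y -> F x <= F y.
Proof. exact: increasing_le. Qed.

(** By betweenness an increment of a summand is dominated by one of [F]. *)
Lemma summand_right_continuous j c x e : D c -> D x -> c < x -> 0 < e ->
  exists z, [/\ D z, c < z <= x & f j z < f j c + e].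
Proof.
move=> Dc Dx cx e0.
have [z [Dz czx zF]] := additive_right_continuous Dc Dx cx e0.
have /andP[cz _] := czx.
exists z; split=> //; rewrite -ltrBlDl additive_increment // ltrBlDl.
have /andP[_ Mz] := updB j Dz Dc cz.
apply: le_lt_trans zF; apply: F_le => //.
by apply: (cm_convex HM) => //; apply: updD.
Qed.

Lemma summand_left_continuous j c x e : D c -> D x -> x < c -> 0 < e ->
  exists z, [/\ D z, x <= z < c & f j c - e < f j z].
Proof.
move=> Dc Dx xc e0.
have [z [Dz xzc zF]] := additive_left_continuous Dc Dx xc e0.
have /andP[_ zc] := xzc.
exists z; split=> //.
have /andP[Mz _] := updB' j Dz Dc zc.
have := additive_increment Dz Dc j.
have : F z <= F (M (upd (pred1 j) z (fun=> c))).
  by apply: F_le => //; apply: (cm_convex HM) => //; apply: updD.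
by move: zF; lra.
Qed.

Hypothesis gauss : forall v, (forall k, I (v k)) -> forall e, 0 < e ->
  exists m, forall i, `|iter m cyclic_map v i - K v| < e.

(** Over a full cycle of shifts each [f j] is evaluated once at each [v k]. *)
Lemma additive_cyclic v : (forall k, D (v k)) ->
  \sum_i F (cyclic_map v i) = \sum_k F (v k).
Proof.
move=> Dv; rewrite (eq_bigr (fun i => \sum_k f k (v (k - i)))); last first.
  by move=> i _; rewrite /cyclic_map FM.
rewrite exchange_big /= [RHS](eq_bigr (fun k => \sum_j f j (v k))); last first.
  by move=> k _; rewrite additive_sum.
rewrite [RHS]exchange_big; apply: eq_bigr => j _ /=.
rewrite (reindex_inj (h := fun i => j - i)) /=; last first.
  by move=> i i' /addrI /oppr_inj.
by apply: eq_bigr => i _; rewrite subKr.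
Qed.

Let iterD v m : (forall k, D (v k)) -> forall k, D (iter m cyclic_map v k).
Proof.
move=> Dv; elim: m => [|m IH] k //=; apply: (cm_convex HM) => // l; exact: IH.
Qed.

(** The sum of the [F (v k)] is invariant along the iteration, whose coordinates
    all tend to [K v]; one-sided continuity of [F] at [K v] suffices to pass to
    the limit. *)
Lemma additive_gauss v : (forall k, D (v k)) ->
  \sum_k F (v k) = F (K v) *+ n.+2.
Proof.
move=> Dv; set c := K v.
have Dc : D c by apply: (cm_convex HK).
have invariant m : \sum_k F (iter m cyclic_map v k) = \sum_k F (v k).
  by elim: m => [//|m <-] /=; rewrite additive_cyclic //; exact: iterD.
have up e : 0 < e -> \sum_k F (v k) <= (F c + e) *+ n.+2.
  move=> e0; suff [m mP] : exists m, forall k, F (iter m cyclic_map v k) <= F c + e.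
    rewrite -(invariant m).
    have -> : (F c + e) *+ n.+2 = \sum_(j < n.+2) (F c + e) by rewrite sumr_const card_ord.
    by apply: ler_sum.
  have [[x [Dx cx]]|Nx] := pselect (exists x, D x /\ c < x); last first.
    (* No point of [D] lies above [c]. *)
    exists 0 => k /=; apply: (@le_trans _ _ (F c)); last by rewrite lerDl ltW.
    by apply: F_le => //; rewrite leNgt; apply/negP => ck; apply: Nx; exists (v k).
  have [z [Dz /andP[cz _] zF]] := additive_right_continuous Dc Dx cx e0.
  have [||m mP] := @gauss v _ (z - c); [by move=> k; apply: DI|by rewrite subr_gt0|].
  exists m => k; apply/ltW; apply: le_lt_trans zF; apply: F_le => //; first exact: iterD.
  have := mP k; rewrite ltr_norml => /andP[_]; rewrite ltrD2r; exact: ltW.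
have lo e : 0 < e -> (F c - e) *+ n.+2 <= \sum_k F (v k).
  move=> e0; suff [m mP] : exists m, forall k, F c - e <= F (iter m cyclic_map v k).
    rewrite -(invariant m).
    have -> : (F c - e) *+ n.+2 = \sum_(j < n.+2) (F c - e) by rewrite sumr_const card_ord.
    by apply: ler_sum.
  have [[x [Dx xc]]|Nx] := pselect (exists x, D x /\ x < c); last first.
    exists 0 => k /=; apply: (@le_trans _ _ (F c)); first by rewrite gerBl ltW.
    by apply: F_le => //; rewrite leNgt; apply/negP => ck; apply: Nx; exists (v k).
  have [z [Dz /andP[_ zc] zF]] := additive_left_continuous Dc Dx xc e0.
  have [||m mP] := @gauss v _ (c - z); [by move=> k; apply: DI|by rewrite subr_gt0|].
  exists m => k; apply/ltW; apply: (lt_le_trans zF); apply: F_le => //; first exact: iterD.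
  by have := mP k; rewrite -normrN opprB ltr_norml => /andP[_]; rewrite ltrD2l ltrN2; exact: ltW.
have n0 : 0 < n.+2%:R :> R by rewrite ltr0n.
apply/eqP; rewrite eq_le; apply/andP; split; apply/ler_addgt0Pr => e e0.
  have /up : 0 < e / n.+2%:R by rewrite divr_gt0.
  by rewrite mulrnDl -[_ / _ *+ _]mulr_natr divfK ?gt_eqF.
have /lo : 0 < e / n.+2%:R by rewrite divr_gt0.
by rewrite mulrnDl mulNrn -[_ / _ *+ _]mulr_natr divfK ?gt_eqF // lerBlDr.
Qed.

End AdditiveMean.

(** * Extending a scale to the whole interval *)

(** Finitely many maps that move points strictly towards [e] carry every point
    near [e] after finitely many applications, in whatever order.  If [P] failed
    at [u], then at the supremum of the points up to which [P] holds all the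
    maps land strictly below it; by the intermediate value property they still
    do so slightly above it. *)
Lemma shrink_cover {R : realType} {L : finType} (h : L -> R -> R) (P : R -> Prop)
    (e d u : R) :
  e < d -> e <= u -> (forall x, e <= x <= d -> P x) ->
  (forall x, e <= x <= u -> (forall i, P (h i x)) -> P x) ->
  (forall i x, e < x <= u -> e <= h i x < x) ->
  (forall i x y, e <= x -> x <= y -> y <= u -> h i x <= h i y) ->
  (forall i x y c, e <= x -> x <= y -> y <= u -> h i x <= c <= h i y ->
     exists z, x <= z <= y /\ h i z = c) ->
  P u.
Proof.
move=> ed eu Pd Ph h_lt h_le h_ivt.
pose A := [set x | e <= x <= u /\ forall y, e <= y <= x -> P y].
have Pe : P e by apply: Pd; rewrite lexx ltW.
have Ae : A e.
  by split=> [|y]; [rewrite lexx | rewrite -eq_le => /eqP <-].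
have uA : has_ubound A by exists u => x [/andP[]].
pose s := sup A; have es : e <= s by apply: ub_le_sup.
have su : s <= u by apply: ge_sup; [exists e | move=> x [/andP[]]].
have below y : e <= y -> y < s -> P y.
  move=> ey /(sup_gt (ex_intro _ e Ae)) [x [_ xP] yx].
  by apply: xP; rewrite ey ltW.
have Ps : P s.
  have [->//|se] := eqVneq s e.
  have es' : e < s by rewrite lt_neqAle eq_sym se.
  apply: Ph => [|i]; first by rewrite es.
  by have /andP[? ?] := h_lt i s (introT andP (conj es' su)); apply: below.
have [->//|su'] := eqVneq u s.
have {}su' : s < u by rewrite lt_neqAle su eq_sym su'.
have below' y : e <= y <= s -> P y.
  by move=> /andP[ey]; rewrite le_eqVlt => /orP[/eqP ->//|]; apply: below.
suff [y sy Py] : exists2 y, s < y <= u & forall z, s <= z <= y -> P z.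
  have /andP[sy' yu] := sy.
  have : y <= s.
    apply: ub_le_sup => //; split=> [|z /andP[ez zy]].
      by rewrite (le_trans es (ltW sy')).
    have [zs|/ltW sz] := leP z s; first by apply: below'; rewrite ez.
    by apply: Py; rewrite sz.
  by rewrite leNgt sy'.
have [se|se] := eqVneq s e.
  exists (Num.min d u); first by rewrite lt_min su' se ed ge_min lexx orbT.
  move=> z /andP[sz]; rewrite le_min => /andP[zd _].
  by apply: Pd; rewrite -se sz.
have es' : e < s by rewrite lt_neqAle eq_sym se.
have y_ex i : exists y, s < y <= u /\ h i y < s.
  have /andP[_ hs] := h_lt i s (introT andP (conj es' su)).
  have [hu|hu] := ltP (h i u) s; first by exists u; rewrite su' lexx.
  have [|z [/andP[sz zu] zE]] := h_ivt i s u ((h i s + s) / 2) es su (lexx _).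
    by rewrite ltW ?midf_lt //= (le_trans _ hu) // ltW // midf_lt.
  exists z; rewrite zu zE midf_lt // andbT lt_neqAle sz andbT; split=> //.
  apply/eqP => sE; move: zE; rewrite -sE => hE.
  by have := (midf_lt hs).1; rewrite -hE ltxx.
have [y yP] := choice y_ex.
exists (\big[Num.min/u]_i y i).
  by apply/andP; split; [apply/bigmin_gtP; split=> // i _; have [/andP[]] := yP i
                        | exact: bigmin_le_id].
move=> z /andP[sz zy]; have ez := le_trans es sz.
have zu : z <= u by apply: (le_trans zy); apply: bigmin_le_id.
apply: Ph => [|i]; first by rewrite ez.
have [/andP[syi yiu] hy] := yP i.
have zyi : z <= y i by apply: (le_trans zy); apply: bigmin_le_cond.
have /andP[ehz _] := h_lt i z (introT andP (conj (lt_le_trans es' sz) zu)).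
by apply: below => //; apply: le_lt_trans hy; apply: h_le.
Qed.

Section Extension.
Context {R : realType} {n : nat} (I : set R).
Notation J := 'I_n.+2.
Variables (M K : (J -> R) -> R).
Hypothesis intI : is_interval I.
Hypothesis HM : cm_mean I M.
Hypothesis HK : cm_mean I K.
Hypothesis bis : forall Y : J -> J -> R, (forall i k, I (Y i k)) ->
  K (fun i => M (fun k => Y i k)) = K (fun j => M (fun k => Y (k - j) k)).
Hypothesis gauss : forall v, (forall k, I (v k)) -> forall e, 0 < e ->
  exists m, forall i, `|iter m (cyclic_map M) v i - K v| < e.

Variables (o e d : R) (g : R -> R).
Hypothesis Io : I o.
Hypothesis Id : I d.
Hypothesis oed : o < e < d.
Hypothesis g_lt : forall x y, o <= x -> y <= d -> x < y -> g x < g y.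
Hypothesis gK : forall v : J -> R, (forall k, o <= v k <= d) ->
  \sum_k g (v k) = g (K v) *+ n.+2.

Let Iod x : o <= x <= d -> I x. Proof. exact: intI. Qed.
Let oede : o <= e <= d. Proof. by have /andP[/ltW-> /ltW->] := oed. Qed.
Let Ie : I e. Proof. exact: Iod. Qed.

(** The maps [t_j] and [k] of the introduction, [k] being the index [None]. *)
Definition shrink (i : option J) x :=
  if i is Some j then M (upd (pred1 j) x (fun=> e))
  else K (upd (pred1 0) x (fun=> e)).

(** Points that any [m] of the maps, in any order, carry into the interval where
    the scale is known. *)
Fixpoint shrunk m x : Prop :=
  if m is m'.+1 then I x /\ forall i, shrunk m' (shrink i x) else o <= x <= d.

Let shrink_lt i x y : I x -> I y -> x < y -> shrink i x < shrink i y.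
Proof.
move=> Ix Iy xy; case: i => [j|] /=.
  by apply: (upd_lt HM) => //; exists j => /=.
by apply: (upd_lt HK) => //; exists 0 => /=.
Qed.

Let shrink_le i x y : I x -> I y -> x <= y -> shrink i x <= shrink i y.
Proof. exact/increasing_le/shrink_lt. Qed.

Let upde A : upd A e (fun _ : J => e) = fun=> e.
Proof. by apply/funext => k; rewrite /upd if_same. Qed.

Let shrink_e i : shrink i e = e.
Proof. by case: i => [j|] /=; rewrite upde ?(cm_const HM) ?(cm_const HK). Qed.

Let shrink_in i x : I x -> I (shrink i x).
Proof.
by move=> Ix; case: i => [j|] /=; [apply: (cm_in HM) | apply: (cm_in HK)];
  apply: updI.
Qed.

Let shrink_toward i x : I x ->
  (e < x -> e <= shrink i x < x) /\ (x < e -> x < shrink i x <= e).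
Proof.
move=> Ix; have ne (j : J) : exists k, ~~ pred1 j k.
  by exists (j + 1); rewrite /= -subr_eq0 addrAC subrr add0r oner_eq0.
split=> [ex|xe]; apply/andP; split.
- by rewrite -[leLHS](shrink_e i) shrink_le // ltW.
- by case: i => [j|] /=; [apply: (upd_cst_lt HM)|apply: (upd_cst_lt HK)].
- by case: i => [j|] /=; rewrite upd_predC;
    [apply: (upd_cst_gt HM)|apply: (upd_cst_gt HK)] => //; apply: ne.
- by rewrite -[leRHS](shrink_e i) shrink_le // ltW.
Qed.

Let shrunk_I m x : shrunk m x -> I x.
Proof. by case: m => [/Iod//|m []]. Qed.

Let shrunk_int m : is_interval (shrunk m).
Proof.
elim: m => [|m IH] x y /= => [/andP[ox _] /andP[_ yd] z /andP[xz zy]|].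
  by rewrite (le_trans ox) // (le_trans zy).
move=> [Ix Sx] [Iy Sy] z /andP[xz zy]; have Iz : I z by apply: (intI Ix Iy); rewrite xz.
by split=> // i; apply: (IH _ _ (Sx i) (Sy i)); rewrite !shrink_le.
Qed.

Let shrunk_e m : shrunk m e.
Proof. by elim: m => [|m IH] //=; split=> // i; rewrite shrink_e. Qed.

Let shrunkS m x : shrunk m x -> shrunk m.+1 x.
Proof.
move=> Sx /=; have Ix := shrunk_I Sx; split=> // i.
have [ex|xe|<-] := ltgtP e x; last by rewrite shrink_e.
  have /andP[? /ltW ?] := (shrink_toward i Ix).1 ex.
  by apply: (shrunk_int (shrunk_e m) Sx); apply/andP.
have /andP[/ltW ? ?] := (shrink_toward i Ix).2 xe.
by apply: (shrunk_int Sx (shrunk_e m)); apply/andP.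
Qed.

Let shrunk_mono m m' x : (m <= m')%N -> shrunk m x -> shrunk m' x.
Proof. by move=> /subnK <- Sx; elim: (m' - m)%N => [|k IH] //; apply: shrunkS. Qed.

Let shrunk_all (L : finType) (v : L -> R) :
  (forall i, exists m, shrunk m (v i)) -> exists m, forall i, shrunk m (v i).
Proof.
move=> /choice[m mP]; exists (\max_i m i)%N => i.
by apply: shrunk_mono (mP i); apply: leq_bigmax.
Qed.

Let shrink_ivt i x y c : I x -> I y -> x <= y ->
  shrink i x <= c <= shrink i y -> exists z, x <= z <= y /\ shrink i z = c.
Proof. by move=> Ix Iy; case: i => [j|] /= ? ?; [apply: (cm_ivt HM)|apply: (cm_ivt HK)]. Qed.

Let shrunk_cover u : I u -> exists m, shrunk m u.
Proof.
move=> Iu; have /andP[oe ed] := oed.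
have build x : I x -> (forall i, exists m, shrunk m (shrink i x)) ->
    exists m, shrunk m x.
  by move=> Ix /shrunk_all[m Sm]; exists m.+1.
have [eu|/ltW ue] := leP e u.
  have Ieu x : e <= x <= u -> I x by apply: intI.
  apply: (@shrink_cover _ _ shrink (fun x => exists m, shrunk m x) e d u) => //.
  - by move=> x /andP[ex xd]; exists 0; rewrite /= xd (le_trans (ltW oe)).
  - by move=> x exu; apply: build; apply: Ieu.
  - move=> i x /andP[ex xu]; apply: (shrink_toward i _).1 => //.
    by apply: Ieu; rewrite ltW.
  - move=> i x y ex xy yu; apply: shrink_le => //; apply: Ieu.
      by rewrite ex (le_trans xy).
    by rewrite yu (le_trans ex).
  - move=> i x y c ex xy yu; apply: shrink_ivt => //; apply: Ieu.
      by rewrite ex (le_trans xy).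
    by rewrite yu (le_trans ex).
have Iue x : - e <= x <= - u -> I (- x).
  by move=> /andP[? ?]; apply: (intI Iu Ie); rewrite lerNr lerNl; apply/andP.
rewrite -[u]opprK.
apply: (@shrink_cover _ _ (fun i x => - shrink i (- x)) (fun x => exists m, shrunk m (- x)) (- e) (- o) (- u)) => //.
- by rewrite ltrN2.
- by rewrite lerN2.
- move=> x /andP[ex xd]; exists 0; rewrite /= lerNr lerNl xd /=.
  by rewrite (le_trans _ ex) // lerN2 ltW.
- move=> x exu Sx; apply: build; first exact: Iue.
  by move=> i; have := Sx i; rewrite opprK.
- move=> i x /andP[ex xu]; rewrite lerNr opprK ltrNl andbC.
  apply: (shrink_toward i _).2; last by rewrite ltrNl.
  by apply: Iue; rewrite ltW.
- move=> i x y ex xy yu; rewrite lerN2; apply: shrink_le; rewrite ?lerN2 //; apply: Iue.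
    by rewrite yu (le_trans ex).
  by rewrite ex (le_trans xy).
- move=> i x y c ex xy yu /andP[xc cy].
  have [||||z [/andP[yz zx] zE]] := @shrink_ivt i (- y) (- x) (- c).
  + by apply: Iue; rewrite yu (le_trans ex).
  + by apply: Iue; rewrite ex (le_trans xy).
  + by rewrite lerN2.
  + by rewrite lerNr cy lerNl xc.
  by exists (- z); rewrite lerNr lerNl zx yz opprK zE opprK.
Qed.

Let kap := shrink None.
Let N : R := n.+2%:R.
Let Npos : 0 < N. Proof. by rewrite /N ltr0n. Qed.

Let depth_ex u : exists m, I u -> shrunk m u.
Proof.
have [/shrunk_cover[m Sm]|] := pselect (I u); first by exists m.
by exists 0%N.
Qed.

Let depth u := projT1 (cid (depth_ex u)).

Let depthP u : I u -> shrunk (depth u) u.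
Proof. by rewrite /depth; case: cid. Qed.

(** [kap] divides [g - g e] by [N], so any number of steps that reaches
    [o, d] gives the same value. *)
Definition extension u := (g (iter (depth u) kap u) - g e) * N ^+ depth u.

Let kap_in m u : shrunk m u -> o <= iter m kap u <= d.
Proof.
by elim: m u => [|m IH] u //= [_ /(_ None)] /IH; rewrite -iterS iterSr.
Qed.

Let kap_od v : o <= v <= d -> o <= kap v <= d.
Proof. by move=> vd; have [_ /(_ None)] := @shrunkS 0 v vd. Qed.

Let g_kap v : o <= v <= d -> (g (kap v) - g e) * N = g v - g e.
Proof.
move=> vd; have ud k : o <= upd (pred1 (0 : J)) v (fun=> e) k <= d.
  by rewrite /upd; case: ifP.
have := gK ud; rewrite (bigD1 0) //= (eq_bigr (fun=> g e)); last first.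
  by move=> k /negbTE k0; rewrite /upd /= k0.
rewrite sumr_const cardC1 card_ord /= /upd /= -/(kap v) mulrBl /N !mulr_natr => <-.
by rewrite mulrS; ring.
Qed.

Let extensionE m u : I u -> o <= iter m kap u <= d ->
  extension u = (g (iter m kap u) - g e) * N ^+ m.
Proof.
move=> Iu; have deeper j k : o <= iter j kap u <= d ->
    (g (iter (k + j) kap u) - g e) * N ^+ (k + j) =
    (g (iter j kap u) - g e) * N ^+ j.
  move=> ju; elim: k => [//|k IH].
  have kju : o <= iter (k + j) kap u <= d by elim: (k) => [//|l IHl]; apply: kap_od.
  by rewrite addSn exprS mulrA [iter _ _ _]/= g_kap.
move=> mu; have := kap_in (depthP Iu); rewrite /extension; move: (depth u) => l lu.
by rewrite -(deeper m l mu) -(deeper l m lu) addnC.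
Qed.

Let kap_iter_I m u : I u -> I (iter m kap u).
Proof. by move=> Iu; elim: m => [//|m IH] /=; apply: shrink_in. Qed.

Let extension_lt x y : I x -> I y -> x < y -> extension x < extension y.
Proof.
move=> Ix Iy xy.
have [m Sm] : exists m, forall b : bool, shrunk m (if b then x else y).
  by apply: shrunk_all => -[]; apply: shrunk_cover.
have [xm ym] := (kap_in (Sm true), kap_in (Sm false)).
rewrite (extensionE Ix xm) (extensionE Iy ym) ltr_pM2r ?exprn_gt0 // ltrD2r.
have [/andP[ox _] /andP[_ yd]] := (xm, ym); apply: g_lt => //.
elim: (m) => [//|k IH] /=; apply: shrink_lt => //; exact: kap_iter_I.
Qed.

Let extension_kap u : I u -> extension (kap u) * N = extension u.
Proof.
move=> Iu; have [m /kap_in um] := shrunk_cover Iu.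
have kum : o <= iter m kap (kap u) <= d by rewrite -iterSr; apply: kap_od.
rewrite (extensionE (shrink_in None Iu) kum) (extensionE Iu um) -iterSr /=.
by rewrite mulrAC g_kap.
Qed.

(** Bisymmetry for the matrix with first row [v] and [e] elsewhere. *)
Let kapM v : (forall k, I (v k)) -> kap (M v) = K (fun j => shrink (Some j) (v j)).
Proof.
move=> Iv; pose Y (i k : J) := if i == 0 then v k else e.
have IY i k : I (Y i k) by rewrite /Y; case: ifP.
have rows : upd (pred1 0) (M v) (fun=> e) = fun i => M (Y i).
  apply/funext => i; rewrite /upd /Y /=; case: eqP => [//|_].
  by rewrite (cm_const HM).
have cols : (fun j => shrink (Some j) (v j)) = fun j => M (fun k => Y (k - j) k).
  apply/funext => j; congr M; apply/funext => k; rewrite /Y /upd /= subr_eq0.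
  by case: eqP => [->|].
by rewrite cols -bis // -rows.
Qed.

(** The averaging rule at depth [m] makes the extension additive along [M] at
    depth [m.+1], and then [additive_gauss] gives back the averaging rule. *)
Let extension_jensen m v : (forall k, shrunk m (v k)) ->
  \sum_k extension (v k) = extension (K v) *+ n.+2.
Proof.
elim: m v => [|m IH] v Sv.
  have Iv k : I (v k) by apply: shrunk_I (Sv k).
  have Kv := cm_between HK Iv Io Id Sv.
  rewrite (@extensionE 0) //; last exact: (cm_in HK).
  rewrite (eq_bigr (fun k => g (v k) - g e)); last first.
    by move=> k _; rewrite (@extensionE 0) ?mulr1 //=; exact: Sv.
  by rewrite sumrB gK // sumr_const card_ord mulr1 mulrnBl.
apply: (additive_gauss HM HK (D := shrunk m.+1) (f := fun j x => extension (shrink (Some j) x))) => //.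
- by move=> x /shrunk_I.
- by move=> x y /shrunk_I Ix /shrunk_I Iy; apply: extension_lt.
move=> w Sw; have Iw k : I (w k) by apply: shrunk_I (Sw k).
rewrite -extension_kap; last exact: (cm_in HM).
rewrite kapM // mulr_natr -IH // => k; exact: (Sw k).2.
Qed.

(** Finitely many points have a common depth. *)
Theorem additive_extension : exists (F : R -> R) (f : J -> R -> R),
  (forall x y, I x -> I y -> x < y -> F x < F y) /\
  (forall v, (forall k, I (v k)) -> F (M v) = \sum_k f k (v k)).
Proof.
exists extension, (fun j x => extension (shrink (Some j) x)); split=> // v Iv.
have [|m Sm] := @shrunk_all _ (fun j => shrink (Some j) (v j)).
  by move=> j; apply: shrunk_cover; apply: shrink_in.
rewrite -extension_kap; last exact: (cm_in HM).
by rewrite kapM // mulr_natr -(extension_jensen Sm).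
Qed.

End Extension.

(** * Row vectors and continuity on the cube *)

Lemma cvg_row {R : realType} {n : nat} {T : Type} (Fi : set_system T) {FF : Filter Fi}
    (v : T -> 'I_n -> R) (w : 'I_n -> R) :
  (forall k, v t k @[t --> Fi] --> w k) ->
  (\row_k v t k) @[t --> Fi] --> (\row_k w k : 'rV[R]_n).
Proof.
move=> vw A /= [P Pw PA]; change (Fi (fun t => A (\row_k v t k))).
have : Fi (fun t => forall k, P ord0 k (v t k)).
  by apply: filter_forall => k; apply: vw; have := Pw ord0 k; rewrite mxE.
by apply: filterS => t Pt; apply: PA => i j; rewrite mxE [i]ord1.
Qed.

Lemma cvg_coord {R : realType} {n : nat} {T : Type} (Fi : set_system T) {FF : Filter Fi}
    (v : T -> 'rV[R]_n) (w : 'rV[R]_n) k :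
  v t @[t --> Fi] --> w -> v t ord0 k @[t --> Fi] --> w ord0 k.
Proof.
move=> vw; apply: (cvg_comp v (fun x : 'rV[R]_n => x ord0 k) vw).
exact: coord_continuous.
Qed.

Lemma iter_ord_pred n (i j : 'I_n.+2) : iter i (@ord_pred n.+2) j = j - i.
Proof.
have predE (k : 'I_n.+2) : ord_pred k = k - 1.
  by apply/val_inj; rewrite /= [(1 %% _)%N]modn_small // subSS subn0 modnDmr addnS.
rewrite -[in RHS](natr_Zp i); elim: (nat_of_ord i) => [|m IH] /=.
  by rewrite subr0.
by rewrite IH predE -natr1 opprD addrA.
Qed.

(** At an end point of [I] one of the two conditions is void, and monotonicity
    gives the bound on that side. *)
Lemma monotone_continuous {R : realType} (I : set R) (h : R -> R) :
  (forall s t, I s -> I t -> s < t -> h s < h t) ->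
  (forall c x e, I c -> I x -> c < x -> 0 < e ->
     exists z, [/\ I z, c < z <= x & h z < h c + e]) ->
  (forall c x e, I c -> I x -> x < c -> 0 < e ->
     exists z, [/\ I z, x <= z < c & h c - e < h z]) ->
  {within I, continuous h}.
Proof.
move=> hlt hr hl; have hle := increasing_le hlt.
apply/subspace_continuousP => c Ic; apply/cvgrPdist_lt => e e0.
have up : \forall t \near c, I t -> h t < h c + e.
  have [[x [Ix cx]]|Nx] := pselect (exists x, I x /\ c < x).
    have [z [Iz /andP[cz _] hz]] := hr c x e Ic Ix cx e0.
    near=> t => It; apply: le_lt_trans hz.
    have tz : t < z by near: t; exact: lt_nbhsl.
    by apply: hle => //; apply: ltW.
  near=> t => It; apply: (@le_lt_trans _ _ (h c)); last by rewrite ltrDl.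
  by apply: hle => //; rewrite leNgt; apply/negP => ct; apply: Nx; exists t.
have lo : \forall t \near c, I t -> h c - e < h t.
  have [[x [Ix xc]]|Nx] := pselect (exists x, I x /\ x < c).
    have [z [Iz /andP[_ zc] hz]] := hl c x e Ic Ix xc e0.
    near=> t => It; apply: (lt_le_trans hz).
    have zt : z < t by near: t; exact: lt_nbhsr.
    by apply: hle => //; apply: ltW.
  near=> t => It; apply: (@lt_le_trans _ _ (h c)); first by rewrite gtrBl.
  by apply: hle => //; rewrite leNgt; apply/negP => ct; apply: Nx; exists t.
suff : \forall t \near c, I t -> `|h c - h t| < e by [].
near=> t => It; rewrite ltr_distlC.
have -> : h c - e < h t by move: It; near: t.
by move: It; near: t.
Unshelve. all: by end_near.
Qed.

Section Bridge.
Context {R : realType} {n : nat} (I : set R).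
Notation J := 'I_n.+2.
Implicit Types (G : 'rV[R]_n.+2 -> R) (v w : J -> R) (x : 'rV[R]_n.+2).

Definition unrow G v := G (\row_k v k).

Lemma row_coordE x : x = \row_k x ord0 k.
Proof. by apply/rowP => k; rewrite mxE. Qed.

Lemma cube_row v : (forall k, I (v k)) -> cube I (\row_k v k).
Proof. by move=> Iv k; rewrite mxE. Qed.

Lemma cyclic_shiftE G (i : J) x :
  cyclic_shift G i x = unrow G (fun k => x ord0 (k - i)).
Proof. by congr G; apply/rowP => k; rewrite !mxE iter_ord_pred. Qed.

Lemma iter_mean_mapE G m v :
  iter m (mean_map (fun i : J => cyclic_shift G i)) (\row_k v k) =
  \row_k iter m (cyclic_map (unrow G)) v k.
Proof.
elim: m => [//|m IH] /=; rewrite IH; apply/rowP => k; rewrite !mxE cyclic_shiftE.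
by congr unrow; apply/funext => l; rewrite mxE.
Qed.

Lemma head_coord x : head 0 [seq x ord0 i | i : J] = x ord0 ord0.
Proof. by rewrite /image_mem enum_ordSl. Qed.

Lemma min_coord_le x k : min_coord x <= x ord0 k.
Proof. exact: bigmin_le. Qed.

Lemma le_min_coord x a : (forall k, a <= x ord0 k) -> a <= min_coord x.
Proof. by move=> ax; apply: le_bigmin => // ; rewrite head_coord. Qed.

Lemma max_coord_ge x k : x ord0 k <= max_coord x.
Proof. exact: le_bigmax. Qed.

Lemma max_coord_le x a : (forall k, x ord0 k <= a) -> max_coord x <= a.
Proof. by move=> xa; apply: bigmax_le => //; rewrite head_coord. Qed.

Lemma mean_reflexive G t : is_mean I G -> I t -> G (const_mx t) = t.
Proof.
move=> [_ Gm] It; have /Gm/andP[lo hi] : cube I (const_mx t : 'rV[R]_n.+2).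
  by move=> k; rewrite mxE.
apply/eqP; rewrite eq_le; apply/andP; split.
  by apply: (le_trans hi); apply: max_coord_le => k; rewrite mxE.
by apply: le_trans lo; apply: le_min_coord => k; rewrite mxE.
Qed.

(** Coordinates are raised one at a time; only some of the steps are strict. *)
Lemma CM_strictly_monotone G v w : is_CM I G ->
  (forall k, I (v k)) -> (forall k, I (w k)) -> (forall k, v k <= w k) ->
  (exists k, v k < w k) -> unrow G v < unrow G w.
Proof.
move=> [_ _ Gs] Iv Iw vw [k0 vwk0].
pose z p (k : J) := if (k < p)%N then w k else v k.
have Iz p k : I (z p k) by rewrite /z; case: ifP.
have zE (k l : J) : l != k -> z k l = z k.+1 l.
  by rewrite /z ltnS -val_eqE /=; case: ltngtP.
have z_lt (k : J) : v k < w k -> unrow G (z k) < unrow G (z k.+1).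
  move=> vwk; apply: (Gs k); try exact: cube_row.
    by move=> l /zE; rewrite !mxE.
  by rewrite !mxE /z ltnn ltnSn.
have z_eq (k : J) : ~~ (v k < w k) -> z k = z k.+1.
  move=> vwk; apply/funext => l; have [->|/zE//] := eqVneq l k.
  by rewrite /z ltnn ltnSn; apply/eqP; rewrite eq_le vw leNgt vwk.
have mono p : (p <= n.+2)%N -> unrow G v <= unrow G (z p) /\
    ((k0 < p)%N -> unrow G v < unrow G (z p)).
  elim: p => [_|p IH pn]; first by split.
  have [le lt] := IH (ltnW pn); pose k : J := Ordinal pn.
  have [/z_lt zz|Nlt] := boolP (v k < w k).
    by split=> [|_]; [apply/ltW|]; apply: (le_lt_trans le).
  rewrite -(z_eq k Nlt); split=> //; rewrite ltnS leq_eqVlt => /orP[/eqP k0p|//].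
  by case/negP: Nlt; suff <- : k0 = k by []; apply/val_inj.
have [_ /(_ (ltn_ord k0))] := mono n.+2 (leqnn _).
by congr (_ < unrow G _); apply/funext => k; rewrite /z ltn_ord.
Qed.

Lemma CM_ivt G (A : pred J) p q c v : is_interval I -> is_CM I G ->
  I p -> I q -> p <= q -> (forall k, I (v k)) ->
  unrow G (upd A p v) <= c <= unrow G (upd A q v) ->
  exists t, p <= t <= q /\ unrow G (upd A t v) = c.
Proof.
move=> intI [_ Gc _] Ip Iq pq Iv /andP[pc cq].
pose r t : 'rV[R]_n.+2 := \row_k upd A t v k.
have Ir t : p <= t <= q -> cube I (r t).
  move=> tpq; apply: cube_row; apply: updI => //; exact: intI tpq.
have rc t : r s @[s --> t] --> r t.
  apply: (cvg_row (Fi := nbhs t) (v := fun s => upd A s v)) => k; rewrite /upd.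
  by case: (A k); [exact: cvg_id | exact: cvg_cst].
have [||t] := @IVT R (fun t => unrow G (upd A t v)) p q c pq.
- apply/subspace_continuousP => t /= tpq U /= GU.
  have {}tpq : p <= t <= q by have := tpq; rewrite in_itv.
  have near_r : \forall s \near t, cube I (r s) -> U (G (r s)).
    exact: rc t _ ((subspace_continuousP _ _).1 Gc (r t) (Ir t tpq) U GU).
  suff : \forall s \near t, `[p, q]%classic s -> U (G (r s)) by [].
  apply: filterS near_r => s rU /= spq; apply: rU; apply: Ir.
  by have := spq; rewrite in_itv.
- by rewrite ge_min pc /= le_max cq orbT.
by rewrite in_itv /= => tpq tc; exists t.
Qed.

Lemma CM_cm_mean G : is_interval I -> is_CM I G -> reflexive_mean I G ->
  cm_mean I (unrow G).
Proof.
move=> intI HG rG; split=> [v Iv|v w|t It|A p q c v].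
- by case: HG => GI _ _; apply: GI; apply: cube_row.
- exact: CM_strictly_monotone.
- rewrite -[RHS](rG t It); congr G; apply/rowP => k; by rewrite !mxE.
- exact: CM_ivt.
Qed.

End Bridge.

(** * Generalized quasi-arithmetic means satisfy the conditions *)

(** Suppose the largest coordinate stayed at or above [e].  Some coordinate is
    at most [c < e], so one summand falls short by at least
    [f j e - f j c]; hence the sum [F] of the summands, taken at the largest
    coordinate, would decrease by a fixed amount at each step. *)
Lemma cyclic_map_upper {R : realType} {n : nat} (I : set R)
    (M : ('I_n.+2 -> R) -> R) (f : 'I_n.+2 -> R -> R) (v : 'I_n.+2 -> R) (c e : R) :
  is_interval I ->
  (forall w, (forall k, I (w k)) -> I (M w)) ->
  (forall j s t, I s -> I t -> s < t -> f j s < f j t) ->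
  (forall w, (forall k, I (w k)) -> \sum_j f j (M w) = \sum_j f j (w j)) ->
  (forall k, I (v k)) -> I c -> c < e ->
  (forall m, exists i, iter m (cyclic_map M) v i <= c) ->
  exists m, forall i, iter m (cyclic_map M) v i < e.
Proof.
move=> intI MI f_lt fM Iv Ic ce below_c; apply: contrapT => /forallNP above.
pose x m := iter m (cyclic_map M) v; pose F t := \sum_j f j t.
have Ix m k : I (x m k).
  by elim: m k => [|m IH] k //=; apply: MI => l; apply: IH.
have f_le j := increasing_le (f_lt j).
have large m : exists2 b, e <= x m b & forall k, x m k <= x m b.
  have [b _ bP] := @arg_maxP _ _ _ (ord0 : 'I_n.+2) predT (x m) isT.
  exists b => [|k]; last exact: bP.
  have [i /negP] := (existsNP _).2 (above m); rewrite -leNgt => ei.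
  by apply: (le_trans ei); apply: bP.
have Ie : I e.
  by have [b eb _] := large 0%N; apply: (intI _ _ Ic (Ix 0%N b)); rewrite (ltW ce).
pose de := \big[Num.min/1]_j (f j e - f j c).
have de0 : 0 < de.
  by apply/bigmin_gtP; split=> // j _; rewrite subr_gt0; apply: f_lt.
have drop m i b : e <= x m b -> (forall k, x m k <= x m b) ->
    F (x m.+1 i) <= F (x m b) - de.
  move=> eb xb; have -> : F (x m.+1 i) = \sum_j f j (x m (j - i)) by apply: fM => k; apply: Ix.
  (* The slot that receives coordinate [l] in the [i]-th shift. *)
  have [l lc] := below_c m; pose j := l + i.
  rewrite /F (bigD1 j) //= [in leRHS](bigD1 j) //= [leRHS]addrAC; apply: lerD.
    rewrite /j addrK lerBrDl; apply: (@le_trans _ _ (de + f j c)).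
      by rewrite lerD2l; apply: f_le.
    rewrite -lerBrDr; apply: (@le_trans _ _ (f j e - f j c)); first exact: bigmin_le.
    by rewrite lerD2r; apply: f_le.
  by apply: ler_sum => k _; apply: f_le => //; exact: xb.
have [b0 _ b0P] := large 0%N.
have bound m i : F (x m i) <= F (x 0%N b0) - m%:R * de.
  elim: m i => [|m IH] i.
    by rewrite mul0r subr0; apply: ler_sum => j _; apply: f_le.
  have [b eb xb] := large m; apply: (le_trans (drop m i b eb xb)).
  by rewrite -natr1 mulrDl mul1r opprD addrA lerD2r.
have [m /ltW] : exists m : nat, (F (x 0%N b0) - F e) / de < m%:R.
  exists (Num.Def.truncn ((F (x 0%N b0) - F e) / de)).+1.
  by apply: truncnS_gt.
move=> mP; have [b eb _] := large m.+1; have := bound m.+1 b.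
have : F e <= F (x m.+1 b) by apply: ler_sum => j _; apply: f_le.
move: mP; rewrite ler_pdivrMr // -natr1 mulrDl mul1r; lra.
Qed.

Lemma cvg_sum_real {R : realType} {J : finType} {T : Type} (Fi : set_system T)
    {FF : Filter Fi} (h : J -> T -> R) (a : J -> R) :
  (forall j, h j x @[x --> Fi] --> a j) ->
  \sum_j h j x @[x --> Fi] --> \sum_j a j.
Proof.
by move=> ha; apply: cvg_big => //; exact: (@pseudometric_normed_Zmodule.add_continuous R R).
Qed.

Section Necessity.
Context {R : realType} {n : nat} (I : set R).
Notation J := 'I_n.+2.
Hypothesis intI : is_interval I.
Variable (f : J -> R -> R).
Hypothesis f_cont : forall i, {within I, continuous (f i)}.
Hypothesis f_lt : forall i s t, I s -> I t -> s < t -> f i s < f i t.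

Let F t := \sum_i f i t.

Let F_lt s t : I s -> I t -> s < t -> F s < F t.
Proof. exact: increasing_sum. Qed.

Let F_inj : {in I &, injective F}.
Proof. by move=> s t /set_mem Is /set_mem It; apply: increasing_inj F_lt _ _ Is It. Qed.

Let f_le i s t : I s -> I t -> s <= t -> f i s <= f i t.
Proof. exact: increasing_le (@f_lt i) s t. Qed.

Lemma gqa_meanP x : cube I x ->
  I (gqa_mean I f x) /\ F (gqa_mean I f x) = \sum_i f i (x ord0 i).
Proof.
move=> Ix.
have [a _ aP] := @arg_minP _ _ _ (ord0 : J) predT (x ord0) isT.
have [b _ bP] := @arg_maxP _ _ _ (ord0 : J) predT (x ord0) isT.
have ab : x ord0 a <= x ord0 b by apply: aP.
have [||t] := @IVT R F (x ord0 a) (x ord0 b) (\sum_i f i (x ord0 i)) ab.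
- apply: (@continuous_subspaceW _ _ _ I).
    by move=> t /=; rewrite in_itv /=; apply: intI.
  apply/subspace_continuousP => t It; apply: (cvg_sum_real (h := f) (a := fun i => f i t)) => i.
  exact: ((subspace_continuousP _ _).1 (@f_cont i) t It).
- rewrite ge_min le_max; apply/andP; split; apply/orP; [left|right].
    by apply: ler_sum => i _; apply: f_le => //; exact: aP.
  by apply: ler_sum => i _; apply: f_le => //; exact: bP.
rewrite in_itv /= => tab tE; have It := intI (Ix a) (Ix b) tab.
by rewrite /gqa_mean -tE (pinvKV _ F_inj) // inE.
Qed.

Section Represented.
Variable G : 'rV[R]_n.+2 -> R.
Hypothesis GI : set_fun (cube I) I G.
Hypothesis FG : forall x, cube I x -> F (G x) = \sum_i f i (x ord0 i).

Let G_lt x z : cube I x -> I z -> F (G x) < F z -> G x < z.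
Proof.
move=> Ix Iz; apply: contraTT; rewrite -!leNgt le_eqVlt => /orP[/eqP ->//|zG].
by apply/ltW/F_lt => //; apply: GI.
Qed.

Let G_gt x z : cube I x -> I z -> F z < F (G x) -> z < G x.
Proof.
move=> Ix Iz; apply: contraTT; rewrite -!leNgt le_eqVlt => /orP[/eqP ->//|zG].
by apply/ltW/F_lt => //; apply: GI.
Qed.

(** For continuity of [G] at [x], a value [z] of [I] slightly above or below
    [G x] turns [F (G y) < F z] into [G y < z], and conversely.  If [I] has no
    point on one side of [G x], the bound on that side is automatic. *)
Lemma represented_CM : is_CM I G.
Proof.
split=> //; last first.
  move=> i x y Ix Iy xy xyi; apply: G_lt => //; first exact: GI.
  rewrite !FG // (bigD1 i) //= [ltRHS](bigD1 i) //=; apply: ltr_leD.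
    exact: f_lt.
  by apply: ler_sum => j ji; rewrite xy.
apply/subspace_continuousP => x Ix; apply/cvgrPdist_lt => e e0.
have Gx : I (G x) by apply: GI.
have S_cont : \sum_i f i (y ord0 i) @[y --> within (cube I) (nbhs x)] --> \sum_i f i (x ord0 i).
  apply: cvg_sum_real => i U /= fU.
  have near_i : \forall t \near x ord0 i, I t -> U (f i t).
    exact: ((subspace_continuousP _ _).1 (@f_cont i) _ (Ix i) U fU).
  have near_x : \forall y \near x, I ((y : 'rV[R]_n.+2) ord0 i) -> U (f i (y ord0 i)).
    exact: (@coord_continuous R 1 n.+2 ord0 i x _ near_i).
  suff : \forall y \near x, cube I y -> U (f i ((y : 'rV[R]_n.+2) ord0 i)) by [].
  by near=> y => Iy; have : I (y ord0 i) by []; near: y.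
have up : \forall y \near x, cube I y -> G y < G x + e.
  have [[z [Iz cz]]|Nz] := pselect (exists z, I z /\ G x < z).
    pose z' := Num.min z (G x + e).
    have cz' : G x < z' by rewrite lt_min cz ltrDl.
    have Iz' : I z' by apply: (intI Gx Iz); rewrite ltW //= ge_min lexx.
    have Fz' : \sum_i f i (x ord0 i) < F z' by rewrite -FG // F_lt.
    have near_x : \forall y \near x, cube I y -> \sum_i f i ((y : 'rV[R]_n.+2) ord0 i) < F z'.
      exact: (S_cont _ (lt_nbhsl Fz')).
    near=> y => Iy; apply: (@lt_le_trans _ _ z'); last by rewrite ge_min lexx orbT.
    by apply: G_lt => //; rewrite FG //; move: Iy; near: y.
  near=> y => Iy; apply: (@le_lt_trans _ _ (G x)); last by rewrite ltrDl.
  by rewrite leNgt; apply/negP => ct; apply: Nz; exists (G y); split=> //; apply: GI.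
have lo : \forall y \near x, cube I y -> G x - e < G y.
  have [[z [Iz zc]]|Nz] := pselect (exists z, I z /\ z < G x).
    pose z' := Num.max z (G x - e).
    have cz' : z' < G x by rewrite gt_max zc gtrBl.
    have Iz' : I z' by apply: (intI Iz Gx); rewrite le_max lexx /= ltW.
    have Fz' : F z' < \sum_i f i (x ord0 i) by rewrite -FG // F_lt.
    have near_x : \forall y \near x, cube I y -> F z' < \sum_i f i ((y : 'rV[R]_n.+2) ord0 i).
      exact: (S_cont _ (lt_nbhsr Fz')).
    near=> y => Iy; apply: (@le_lt_trans _ _ z'); first by rewrite le_max lexx orbT.
    by apply: G_gt => //; rewrite FG //; move: Iy; near: y.
  near=> y => Iy; apply: (@lt_le_trans _ _ (G x)); first by rewrite gtrBl.
  by rewrite leNgt; apply/negP => ct; apply: Nz; exists (G y); split=> //; apply: GI.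
suff : \forall y \near x, cube I y -> `|G x - G y| < e by [].
near=> y => Iy; rewrite ltr_distlC.
have -> : G x - e < G y by move: Iy; near: y.
by move: Iy; near: y.
Unshelve. all: by end_near.
Qed.

Lemma represented_reflexive : reflexive_mean I G.
Proof.
move=> t It; have It' : cube I (const_mx t : 'rV[R]_n.+2) by move=> k; rewrite mxE.
apply: F_inj; rewrite ?inE //; first exact: GI.
by rewrite FG //; apply: eq_bigr => i _; rewrite mxE.
Qed.

Lemma represented_strict_mean : is_strict_mean I G.
Proof.
have HG := CM_cm_mean intI represented_CM represented_reflexive.
have extremes (x : 'rV[R]_n.+2) : cube I x -> exists a b, [/\ forall k, x ord0 a <= x ord0 k <= x ord0 b,
    min_coord x = x ord0 a & max_coord x = x ord0 b].
  move=> Ix; have [a [b [xab _]]] := cm_minmax HG (v := x ord0) Ix.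
  exists a, b; split=> //; apply/eqP; rewrite eq_le ?min_coord_le ?max_coord_ge ?andbT /=.
    by apply: le_min_coord => k; have /andP[] := xab k.
  by apply: max_coord_le => k; have /andP[] := xab k.
split.
  split=> // x Ix; have [a [b [xab -> ->]]] := extremes x Ix.
  by rewrite [x in G x]row_coordE; apply: (cm_between HG (v := x ord0)).
move=> x Ix; have [a [b [xab -> ->]]] := extremes x Ix => ab.
have Ia := represented_reflexive (Ix a); have Ib := represented_reflexive (Ix b).
have cst_row t : G (const_mx t) = unrow G (fun=> t).
  by congr G; apply/rowP => k; rewrite !mxE.
have -> : G x = unrow G (x ord0) by rewrite /unrow -row_coordE.
rewrite -{1}Ia -{1}Ib !cst_row.
apply/andP; split; apply: (cm_lt HG) => //; try by move=> k; have /andP[] := xab k.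
  by exists b.
by exists a.
Qed.

End Represented.
End Necessity.

(** [avg] generates the quasi-arithmetic mean [K0] of the scale [F], and [K0]
    turns out to be the Gauss composition of the cyclic shifts of [M]. *)
Section GqaNecessity.
Context {R : realType} {n : nat} (I : set R) (M : 'rV[R]_n.+2 -> R).
Notation J := 'I_n.+2.
Hypothesis intI : is_interval I.
Hypothesis MI : set_fun (cube I) I M.
Variable (f : J -> R -> R).
Hypothesis f_cont : forall i, {within I, continuous (f i)}.
Hypothesis f_lt : forall i s t, I s -> I t -> s < t -> f i s < f i t.
Hypothesis M_gqa : {in cube I, M =1 gqa_mean I f}.

Let F t := \sum_i f i t.
Let avg (i : J) t := F t / n.+2%:R.

Let n0 : n.+2%:R != 0 :> R. Proof. by rewrite pnatr_eq0. Qed.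

Let F_lt s t : I s -> I t -> s < t -> F s < F t.
Proof. exact: increasing_sum. Qed.

Let F_inj s t : I s -> I t -> F s = F t -> s = t.
Proof. exact: (increasing_inj F_lt). Qed.

Let avg_lt i s t : I s -> I t -> s < t -> avg i s < avg i t.
Proof. by move=> Is It st; rewrite ltr_pM2r ?invr_gt0 ?ltr0n // F_lt. Qed.

Let avg_cont i : {within I, continuous (avg i)}.
Proof.
apply/subspace_continuousP => t It; apply: cvgMl.
apply: (cvg_sum_real (h := f) (a := fun i => f i t)) => j.
exact: ((subspace_continuousP _ _).1 (@f_cont j) t It).
Qed.

Let avg_sum t : \sum_i avg i t = F t.
Proof. by rewrite /avg sumr_const card_ord -[LHS]mulr_natr divfK. Qed.

Let FM x : cube I x -> F (M x) = \sum_i f i (x ord0 i).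
Proof. by move=> Ix; rewrite M_gqa ?inE //; have [] := gqa_meanP intI f_cont f_lt Ix. Qed.

Let K0 := gqa_mean I avg.

Let K0I : set_fun (cube I) I K0.
Proof. by move=> x Ix; have [] := gqa_meanP intI avg_cont avg_lt Ix. Qed.

Let FK0 x : cube I x -> F (K0 x) *+ n.+2 = \sum_i F (x ord0 i).
Proof.
move=> Ix; have [_] := gqa_meanP intI avg_cont avg_lt Ix.
by rewrite avg_sum => ->; rewrite -mulr_suml -[LHS]mulr_natr divfK.
Qed.

Let avgK0 x : cube I x -> \sum_i avg i (K0 x) = \sum_i avg i (x ord0 i).
Proof. by move=> Ix; have [] := gqa_meanP intI avg_cont avg_lt Ix. Qed.

Let M_CM : is_CM I M. Proof. exact: (represented_CM intI f_cont f_lt MI FM). Qed.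

Let M_refl : reflexive_mean I M.
Proof. exact: (represented_reflexive f_lt MI FM). Qed.

Let HM : cm_mean I (unrow M). Proof. exact: CM_cm_mean. Qed.

Let K0_CM : is_CM I K0.
Proof. exact: (represented_CM intI avg_cont avg_lt K0I avgK0). Qed.

Let HK0 : cm_mean I (unrow K0).
Proof.
by apply: CM_cm_mean => //; exact: (represented_reflexive avg_lt K0I avgK0).
Qed.

Let x_in (v : J -> R) m : (forall k, I (v k)) ->
  forall k, I (iter m (cyclic_map (unrow M)) v k).
Proof.
by move=> Iv; elim: m => [//|m IH] k /=; apply: (cm_in HM) => l; apply: IH.
Qed.

Let FM' w : (forall k, I (w k)) ->
  \sum_j f j (unrow M w) = \sum_j f j (w j).
Proof.
move=> Iw; rewrite -/(F _) FM; last exact: cube_row.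
by apply: eq_bigr => j _; rewrite mxE.
Qed.

Let K0_iter (v : J -> R) m : (forall k, I (v k)) ->
  unrow K0 (iter m (cyclic_map (unrow M)) v) = unrow K0 v.
Proof.
move=> Iv; elim: m => [//|m <-]; set x := iter m _ v.
have Ix k : I (x k) by apply: x_in.
apply: F_inj; try by apply: (cm_in HK0) => k; do ?apply: (cm_in HM).
have E w : (forall k, I (w k)) -> F (unrow K0 w) *+ n.+2 = \sum_k F (w k).
  by move=> Iw; rewrite FK0; [apply: eq_bigr => k _; rewrite mxE | exact: cube_row].
have : F (unrow K0 (iter m.+1 (cyclic_map (unrow M)) v)) *+ n.+2 = F (unrow K0 x) *+ n.+2.
  rewrite !E //; last by apply: x_in.
  by apply: (additive_cyclic HM (D := I) (f := f)) => // w; apply: FM'.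
by move/eqP; rewrite -subr_eq0 -mulrnBl mulrn_eq0 subr_eq0 => /eqP.
Qed.

Let iter_upper (v : J -> R) e : (forall k, I (v k)) -> 0 < e ->
  exists m, forall i, iter m (cyclic_map (unrow M)) v i < unrow K0 v + e.
Proof.
move=> Iv e0; apply: (cyclic_map_upper intI (cm_in HM) f_lt FM' Iv (cm_in HK0 Iv)).
  by rewrite ltrDl.
move=> m; have [i [_ [_ /andP[iK _]]]] := cm_minmax HK0 (x_in m Iv).
by exists i; rewrite -(K0_iter m Iv).
Qed.

(** The bound from above for the means reflected by [z |-> - z]. *)
Let iter_lower (v : J -> R) e : (forall k, I (v k)) -> 0 < e ->
  exists m, forall i, unrow K0 v - e < iter m (cyclic_map (unrow M)) v i.
Proof.
move=> Iv e0; pose M' w := - unrow M (fun k : J => - w k).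
have iterN m : iter m (cyclic_map M') (fun k => - v k) =
    fun k => - iter m (cyclic_map (unrow M)) v k.
  elim: m => [//|m IH]; apply/funext => i; rewrite /= IH /cyclic_map /M'.
  by congr (- unrow M _); apply/funext => k; rewrite opprK.
have [||||||||m mP] := @cyclic_map_upper R n [set x | I (- x)] M'
  (fun j x => - f j (- x)) (fun k => - v k) (- unrow K0 v) (- unrow K0 v + e).
- move=> x y Ix Iy z /andP[xz zy]; apply: (intI Iy Ix); by rewrite !lerN2 zy.
- by move=> w Iw; rewrite /= opprK; apply: (cm_in HM).
- by move=> j s t Is It st; rewrite ltrN2; apply: f_lt => //; rewrite ltrN2.
- by move=> w Iw; rewrite !sumrN; congr (- _); rewrite /M' opprK FM'.
- by move=> k; rewrite /= opprK.
- by rewrite /= opprK; apply: (cm_in HK0).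
- by rewrite ltrDl.
- move=> m; have [_ [j [_ /andP[_ Kj]]]] := cm_minmax HK0 (x_in m Iv).
  by exists j; rewrite iterN lerN2 -(K0_iter m Iv).
by exists m => i; have := mP i; rewrite iterN ltrNl opprD opprK.
Qed.

Let iter_near (v : J -> R) e : (forall k, I (v k)) -> 0 < e ->
  \forall m \near \oo, forall i,
    `|unrow K0 v - iter m (cyclic_map (unrow M)) v i| < e.
Proof.
move=> Iv e0; have [m1 m1P] := iter_upper Iv e0; have [m2 m2P] := iter_lower Iv e0.
exists (m1 + m2)%N => // m /= mm i; rewrite ltr_distlC.
have up k : forall j, iter (k + m1) (cyclic_map (unrow M)) v j < unrow K0 v + e.
  elim: k => [|k IH] j; first exact: m1P.
  have [a [b [_ /andP[_ Mb]]]] := cm_minmax HM (fun l => x_in (k + m1) Iv (l - j)).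
  exact: (le_lt_trans Mb (IH _)).
have lo k : forall j, unrow K0 v - e < iter (k + m2) (cyclic_map (unrow M)) v j.
  elim: k => [|k IH] j; first exact: m2P.
  have [a [b [_ /andP[aM _]]]] := cm_minmax HM (fun l => x_in (k + m2) Iv (l - j)).
  exact: (lt_le_trans (IH _) aM).
have := up (m - m1)%N i; have := lo (m - m2)%N i.
by rewrite !subnK ?(leq_trans _ mm) ?leq_addr ?leq_addl // => -> ->.
Qed.

Let gauss_K0 : is_gauss_composition I (fun i : J => cyclic_shift M i) K0.
Proof.
split=> [||x Ix]; first exact: (represented_strict_mean intI avg_cont avg_lt K0I avgK0).
  by case: K0_CM.
rewrite (_ : const_mx _ = \row_k K0 x); last by apply/rowP => k; rewrite !mxE.
have -> : (fun m => iter m (mean_map (fun i : J => cyclic_shift M i)) x) =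
    fun m => \row_k iter m (cyclic_map (unrow M)) (x ord0) k.
  by apply/funext => m; rewrite -iter_mean_mapE -row_coordE.
apply: cvg_row => k; apply/cvgrPdist_lt => e e0.
have near_k := iter_near (v := x ord0) Ix e0.
near=> m; have -> : K0 x = unrow K0 (x ord0) by rewrite /unrow -row_coordE.
have : forall i, `|unrow K0 (x ord0) - iter m (cyclic_map (unrow M)) (x ord0) i| < e.
  by near: m; exact: near_k.
exact.
Unshelve. all: by end_near.
Qed.

Let gaussP : is_gauss_composition I (fun i : J => cyclic_shift M i) (cyclic_gauss I M).
Proof. by apply: getPex; exists K0. Qed.

Let gaussE x : cube I x -> cyclic_gauss I M x = K0 x.
Proof.
move=> Ix; have [_ _ /(_ x Ix) cvg1] := gaussP; have [_ _ /(_ x Ix) cvg2] := gauss_K0.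
have := @norm_cvg_unique _ R _ _ _ _ (cvg_coord (k := ord0) cvg1) (cvg_coord (k := ord0) cvg2).
by move=> /(_ _ _ _); rewrite !mxE; apply.
Qed.

(** In the scale [F] both sides of the bisymmetry equation are the sum of all
    [f k (x i (k - i))], over rows or over columns. *)
Theorem gqa_bisymmetric : [/\ is_CM I M, reflexive_mean I M &
  is_CM I (cyclic_gauss I M) /\ generalized_bisymmetric I M].
Proof.
split=> //; split.
  have [[[KI _] _] Kc _] := gaussP; split=> // i x y Ix Iy xy lt.
  by rewrite !gaussE //; case: K0_CM => _ _; apply; eassumption.
move=> x Ix.
have rows : cube I (\row_i cyclic_shift M i (\row_j x i j)).
  by move=> i; rewrite mxE cyclic_shiftE; apply: (cm_in HM) => k; rewrite mxE.
have cols : cube I (\row_j cyclic_shift M j (\row_i x i j)).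
  by move=> j; rewrite mxE cyclic_shiftE; apply: (cm_in HM) => k; rewrite mxE.
rewrite !gaussE //; apply: F_inj; [exact: K0I|exact: K0I|].
suff : F (K0 (\row_i cyclic_shift M i (\row_j x i j))) *+ n.+2 =
    F (K0 (\row_j cyclic_shift M j (\row_i x i j))) *+ n.+2.
  by move/eqP; rewrite -subr_eq0 -mulrnBl mulrn_eq0 subr_eq0 => /eqP.
rewrite !FK0 //.
rewrite (eq_bigr (fun i => \sum_k f k (x i (k - i)))); last first.
  move=> i _; rewrite mxE cyclic_shiftE /F FM'; last by move=> k; rewrite mxE.
  by apply: eq_bigr => k _; rewrite mxE.
rewrite [RHS](eq_bigr (fun j => \sum_k f k (x (k - j) j))); last first.
  move=> j _; rewrite mxE cyclic_shiftE /F FM'; last by move=> k; rewrite mxE.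
  by apply: eq_bigr => k _; rewrite mxE.
rewrite exchange_big [RHS]exchange_big; apply: eq_bigr => k _ /=.
rewrite [RHS](reindex_inj (h := fun i => k - i)) /=; last first.
  by move=> i i' /addrI /oppr_inj.
by apply: eq_bigr => i _; rewrite subKr.
Qed.

End GqaNecessity.

(** * The conditions produce a generalized quasi-arithmetic mean *)

Section Sufficiency.
Context {R : realType} {n : nat} (I : set R) (M : 'rV[R]_n.+2 -> R).
Notation J := 'I_n.+2.
Hypothesis hI : nondegenerate_interval I.

Let intI : is_interval I. Proof. by case: hI. Qed.

(** If no Gauss composition existed, [cyclic_gauss I M] would be the default
    function, which is constant and so not strictly increasing.  Thus its being
    a CM-function entails its defining property. *)
Lemma CM_cyclic_gaussP : is_CM I (cyclic_gauss I M) ->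
  is_gauss_composition I (fun i : J => cyclic_shift M i) (cyclic_gauss I M).
Proof.
move=> [_ _ Ks].
have [exK|/forallNP/getPN KE] := pselect (exists K,
  is_gauss_composition I (fun i : J => cyclic_shift M i) K); first exact: getPex exK.
case: hI => _ [a [b [Ia Ib ab]]].
suff : cyclic_gauss I M (const_mx a) <
    cyclic_gauss I M (\row_k (if k == ord0 then b else a)).
  by rewrite /cyclic_gauss /gauss_composition KE ltxx.
apply: (Ks ord0); last by rewrite !mxE eqxx.
- by move=> k; rewrite mxE.
- by move=> k; rewrite mxE; case: ifP.
- by move=> k /negbTE k0; rewrite !mxE k0.
Qed.

Let K := cyclic_gauss I M.
Hypothesis M_CM : is_CM I M.
Hypothesis M_refl : reflexive_mean I M.
Hypothesis K_CM : is_CM I K.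
Hypothesis M_bis : generalized_bisymmetric I M.

Let HM : cm_mean I (unrow M). Proof. exact: CM_cm_mean. Qed.

Let HK : cm_mean I (unrow K).
Proof.
apply: CM_cm_mean => // t It; apply: mean_reflexive It.
by have [[]] := CM_cyclic_gaussP K_CM.
Qed.

(** Bisymmetry in slot form: entry [(i, j)] of the matrix is fed to slot
    [i + j]. *)
Let K_bis (Y : J -> J -> R) : (forall i k, I (Y i k)) ->
  unrow K (fun i => unrow M (fun k => Y i k)) =
  unrow K (fun j => unrow M (fun k => Y (k - j) k)).
Proof.
move=> IY; have := @M_bis (\matrix_(i, j) Y i (i + j)).
have IX i j : I ((\matrix_(i, j) Y i (i + j)) i j) by rewrite mxE.
move=> /(_ IX); congr (K _ = K _); apply/rowP => i; rewrite !mxE cyclic_shiftE.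
  by congr unrow; apply/funext => k; rewrite !mxE addrC subrK.
by congr unrow; apply/funext => k; rewrite !mxE subrK.
Qed.

Let near_K (v : J -> R) : (forall k, I (v k)) -> forall e, 0 < e ->
  \forall m \near \oo, forall i, `|iter m (cyclic_map (unrow M)) v i - unrow K v| < e.
Proof.
move=> Iv e e0; have [_ _ cvgK] := CM_cyclic_gaussP K_CM.
have {}cvgK := cvgK _ (cube_row Iv).
apply: filter_forall => i; have := (cvgrPdist_lt _ _).1 (cvg_coord (k := i) cvgK) e e0.
move=> near_i; near=> m; rewrite distrC.
have : `|(const_mx (K (\row_k v k)) : 'rV[R]_n.+2) ord0 i -
    iter m (mean_map (fun j : J => cyclic_shift M j)) (\row_k v k) ord0 i| < e.
  by near: m; exact: near_i.
by rewrite iter_mean_mapE !mxE.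
Unshelve. all: by end_near.
Qed.

(** A rotation of the starting point only rotates the iterates, and their limit
    is diagonal. *)
Let K_cyclic (a : J) (v : J -> R) : (forall k, I (v k)) ->
  unrow K (fun k => v (k + a)) = unrow K v.
Proof.
move=> Iv; set w := fun k => v (k + a).
have Iw k : I (w k) by apply: Iv.
have iterE m : exists a', iter m (cyclic_map (unrow M)) w =
    fun k => iter m (cyclic_map (unrow M)) v (k + a').
  elim: m => [|m [a' IH]]; first by exists a.
  exists (- a'); apply/funext => i; rewrite /= IH /cyclic_map.
  by congr unrow; apply/funext => k; congr (iter _ _ _ _); rewrite opprD opprK addrA.
apply/eqP; rewrite -subr_eq0 -normr_le0; apply/ler_addgt0Pr => e e0.
have e20 : 0 < e / 2 by rewrite divr_gt0.
have [m [mw mv]] := filter_ex (filterI (near_K Iw e20) (near_K Iv e20)).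
have [a' E] := iterE m; have := mw 0; have := mv (0 + a'); rewrite E => mv' mw'.
rewrite add0r [e]splitr ltW //; apply: le_lt_trans (ltrD mw' mv').
by rewrite [X in _ <= X + _]distrC ler_distD.
Qed.

Theorem bisymmetric_gqa : is_gqa_mean I M.
Proof.
case: hI => _ [p [t [Ip It pt]]].
have [d [g [/andP[pd dt] g_lt gK]]] :=
  local_scale intI HM HK K_cyclic K_bis Ip It pt.
have Id : I d by apply: (intI Ip It); rewrite (ltW pd).
have gauss v : (forall k, I (v k)) -> forall e, 0 < e ->
    exists m, forall i, `|iter m (cyclic_map (unrow M)) v i - unrow K v| < e.
  by move=> Iv e e0; exact: (filter_ex (near_K Iv e0)).
have ped : p < (p + d) / 2 < d by rewrite !midf_lt.
have [F [f [F_lt FM]]] :=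
  additive_extension intI HM HK K_bis gauss Ip Id ped g_lt gK.
have f_lt j x y : I x -> I y -> x < y -> f j x < f j y.
  by apply: (additive_lt HM intI _ F_lt FM).
have FE x : I x -> F x = \sum_j f j x by apply: (additive_sum HM).
exists f; split=> [j|j x y /set_mem Ix /set_mem Iy|x /set_mem Ix].
- apply: monotone_continuous => [|c x e|c x e]; first exact: f_lt.
  + by apply: (summand_right_continuous HM intI _ F_lt FM).
  + by apply: (summand_left_continuous HM intI _ F_lt FM).
- exact: f_lt.
have IMx : I (M x) by case: M_CM => MI _ _; apply: MI.
have FMx : \sum_j f j (x ord0 j) = \sum_j f j (M x).
  by rewrite -FE // [x in M x]row_coordE -/(unrow M _) FM.
have F_inj : {in I &, injective (fun t => \sum_j f j t)}.
  by move=> s r /set_mem Is /set_mem Ir; rewrite -!FE //; apply: increasing_inj F_lt _ _ Is Ir.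
by rewrite /gqa_mean FMx (pinvKV _ F_inj) // inE.
Qed.

End Sufficiency.

Theorem theorem5 (R : realType) (n : nat) (hn : (2 <= n)%N) (I : set R)
    (hI : nondegenerate_interval I) (M : 'rV[R]_n -> R)
    (hM : set_fun (cube I) I M) :
  is_gqa_mean I M <->
  [/\ is_CM I M,
      reflexive_mean I M &
      is_CM I (cyclic_gauss I M) /\ generalized_bisymmetric I M].
Proof.
case: n hn M hM => [//|[//|n]] _ M hM; split.
  move=> [f [f_cont f_lt M_gqa]].
  apply: (gqa_bisymmetric hI.1 hM f_cont _ M_gqa) => i s t Is It.
  by apply: f_lt; rewrite inE.
by move=> [M_CM M_refl [K_CM M_bis]]; apply: bisymmetric_gqa.
Qed.
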